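(* Let $n\ge 1$ and $m\ge 1$, and let $X=\Gamma(4m)\backslash\mathfrak h_n$. The involution $\tau(Z)=-\overline Z$ of $\mathfrak h_n$ descends to an anti-holomorphic involution of $X$; let $X_{\mathbb R}$ be its fixed point set. Let $S=\bigcup_{\gamma\in\Gamma(4m)}\mathfrak h_n^{\gamma}\subset\mathfrak h_n$. Then: (i) $X_{\mathbb R}$ is exactly the image of $S$ in $X$. (ii) For each $g\in\Gamma_{2m}(2)$, the group ${}^g\Gamma_\ell(4m)=g\Gamma_\ell(4m)g^{-1}$ preserves $g\cdot iC_n$, and the projection $\mathfrak h_n\to X$ induces an injective map from ${}^g\Gamma_\ell(4m)\backslash g\cdot iC_n$ (a copy of $\Gamma_\ell(4m)\backslash C_n$) into $X_{\mathbb R}$. This image depends only on the double coset $\Gamma(4m)\,g\,\Gamma_\ell(2)$, images of distinct double cosets are disjoint, the double coset space $\Gamma(4m)\backslash\Gamma_{2m}(2)/\Gamma_\ell(2)$ is finite, and $$X_{\mathbb R}=\coprod_{g\in\Gamma(4m)\backslash\Gamma_{2m}(2)/\Gamma_\ell(2)}{}^g\Gamma_\ell(4m)\backslash g\cdot iC_n.$$ (iii) The map sending the double coset of $g\in\Gamma_{2m}(2)$ to the cohomology class of the cocycle $f_{\tilde g g^{-1}}$ (note $\tilde gg^{-1}\in\Gamma(4m)$) is a bijection $\Gamma(4m)\backslash\Gamma_{2m}(2)/\Gamma_\ell(2)\to H^1(\mathbb C/\mathbb R,\Gamma(4m))$; thus the copy indexed by $g$ corresponds to the class of $f_\gamma$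 with $\gamma=\tilde gg^{-1}$.
   Context: $\mathbf{Sp}(2n,\mathbb R)$ is the group of real $2n\times 2n$ matrices $g=\begin{pmatrix}A&B\\C&D\end{pmatrix}$ ($n\times n$ blocks) with ${}^tgJg=J$, $J=\begin{pmatrix}0&I_n\\-I_n&0\end{pmatrix}$. Define the involution $\tau\begin{pmatrix}A&B\\C&D\end{pmatrix}=\begin{pmatrix}A&-B\\-C&D\end{pmatrix}$ and write $\tilde g=\tau(g)$. The Siegel space $\mathfrak h_n=\{Z\in M_n(\mathbb C):{}^tZ=Z,\ \mathrm{Im}Z>0\}$ carries the action $gZ=(AZ+B)(CZ+D)^{-1}$; on $\mathfrak h_n$, $\tau(Z)=-\overline Z$, and $\tau(gZ)=\tau(g)\tau(Z)$. For $\gamma\in\mathbf{Sp}(2n,\mathbb R)$, $\mathfrak h_n^\gamma=\{Z\in\mathfrak h_n:\gamma Z=\tau(Z)\}$. $\mathbf{GL}(n,\mathbb R)$ is embedded in $\mathbf{Sp}(2n,\mathbb R)$ by $A\mapsto\mathrm{diag}(A,{}^tA^{-1})$. $C_n$ is the cone of positive definite symmetric real $n\times n$ matrices and $iC_n=\{iY:Y\in C_n\}\subset\mathfrak h_n$. Groups: $\Gamma(N)=\{\gamma\in\mathbf{Sp}(2n,\mathbb Z):\gamma\equiv I\bmod N\}$; $\Gamma_{2m}(2)=\{\begin{pmatrix}A&B\\C&D\end{pmatrix}\in\mathbf{Sp}(2n,\mathbb Z): A,D\equiv I\bmod 2,\ B,C\equiv 0\bmod 2m\}$; $\Gamma_\ell(N)=\{\gamma\in\mathbf{GL}(n,\mathbb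 Z):\gamma\equiv I\bmod N\}$, viewed inside $\mathbf{Sp}(2n,\mathbb Z)$ via the embedding above. Galois cohomology: for a $\tau$-stable subgroup $H$ and $\gamma\in H$ with $\gamma\tilde\gamma=I$, $f_\gamma$ denotes the 1-cocycle $\mathrm{Gal}(\mathbb C/\mathbb R)=\{1,\tau\}\to H$, $1\mapsto I$, $\tau\mapsto\gamma$; $f_\gamma$ and $f_{\gamma'}$ are cohomologous if $\gamma'=\tilde h\gamma h^{-1}$ for some $h\in H$; $H^1(\mathbb C/\mathbb R,H)$ is the set of cohomology classes. *)

(* Defs.v *)
From HB Require Import structures.
From mathcomp Require Import all_boot all_order all_algebra.
From mathcomp Require Import all_classical all_reals.
From mathcomp.real_closed Require Import complex.
Set Implicit Arguments. Unset Strict Implicit. Unset Printing Implicit Defensive.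
Import Order.TTheory GRing.Theory Num.Theory.
Local Open Scope ring_scope.
Local Open Scope classical_set_scope.

Section Defs.
Variable R : realType.
Variable n : nat.

Local Notation C := (R[i]).
Local Notation M2 := ('M[R]_(n + n)).
Local Notation Mc := ('M[C]_n).

Definition Jmx : M2 := block_mx 0 1%:M (- 1%:M) 0.

Definition Sp : set M2 := [set g | g^T *m Jmx *m g = Jmx].

Definition tau (g : M2) : M2 :=
  block_mx (ulsubmx g) (- ursubmx g) (- dlsubmx g) (drsubmx g).

Definition intmx p q (A : 'M[R]_(p, q)) : Prop :=
  forall i j, A i j \is a Num.int.
Definition congrmx p q (N : nat) (A B : 'M[R]_(p, q)) : Prop :=
  forall i j, (A i j - B i j) / N%:R \is a Num.int.

Definition SpZ : set M2 := [set g | Sp g /\ intmx g].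

Definition GammaN (N : nat) : set M2 := [set g | SpZ g /\ congrmx N g 1%:M].

Definition Gamma2m2 (m : nat) : set M2 :=
  [set g | SpZ g /\ congrmx 2 (ulsubmx g) 1%:M /\ congrmx 2 (drsubmx g) 1%:M
         /\ congrmx (2 * m) (ursubmx g) 0 /\ congrmx (2 * m) (dlsubmx g) 0].

Definition embGL (A : 'M[R]_n) : M2 := block_mx A 0 0 (invmx A^T).

Definition GLZ : set 'M[R]_n :=
  [set A | A \in unitmx /\ intmx A /\ intmx (invmx A)].

Definition GammaL (N : nat) : set M2 :=
  [set embGL A | A in [set A | GLZ A /\ congrmx N A 1%:M]].

Definition toC p q (A : 'M[R]_(p, q)) : 'M[C]_(p, q) := map_mx (fun x => (x%:C)%C) A.

Definition posdef (Y : 'M[R]_n) : Prop :=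
  forall v : 'cV[R]_n, v != 0 -> 0 < (v^T *m Y *m v) 0 0.
Definition Cn : set 'M[R]_n := [set Y | Y^T = Y /\ posdef Y].

Definition hn : set Mc := [set Z | Z^T = Z /\ posdef (map_mx (@complex.Im R) Z)].

Definition act (g : M2) (Z : Mc) : Mc :=
  (toC (ulsubmx g) *m Z + toC (ursubmx g)) *m
    invmx (toC (dlsubmx g) *m Z + toC (drsubmx g)).

Definition tauZ (Z : Mc) : Mc := - map_mx (@conjc R) Z.

Definition hn_fix (gamma : M2) : set Mc := [set Z | hn Z /\ act gamma Z = tauZ Z].

Definition iY (Y : 'M[R]_n) : Mc := map_mx (fun y => (0 +i* y)%C) Y.

Definition giCn (g : M2) : set Mc := [set act g (iY Y) | Y in Cn].

(* X = Gamma \ h_n : its points are the Gamma-orbits of points of h_n *)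
Definition Gorbit (G : set M2) (Z : Mc) : set Mc := [set act gamma Z | gamma in G].
Definition Xpts (G : set M2) : set (set Mc) := [set Gorbit G Z | Z in hn].

Definition tauX (O : set Mc) : set Mc := tauZ @` O.

Definition XR (G : set M2) : set (set Mc) := [set O | Xpts G O /\ tauX O = O].

Definition dcoset (G L : set M2) (g : M2) : set M2 :=
  [set x | exists2 gamma, G gamma & exists2 k, L k & x = gamma *m g *m k].

(* Galois cohomology of Gal(C/R) = {1, tau} with values in H:
   the cocycle f_gamma (1 |-> I, tau |-> gamma) requires gamma tau(gamma) = I *)
Definition cocycle (H : set M2) (gamma : M2) : Prop :=
  H gamma /\ gamma *m tau gamma = 1%:M.
Definition cohomologous (H : set M2) (gamma gamma' : M2) : Prop :=
  exists2 h, H h & gamma' = tau h *m gamma *m invmx h.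

End Defs.

(* Main.v *)
Require Import Defs.
From HB Require Import structures.
From mathcomp Require Import all_boot all_order all_algebra.
From mathcomp Require Import all_classical all_reals.
From mathcomp.real_closed Require Import complex.
From mathcomp Require Import zify ring lra.
Set Implicit Arguments. Unset Strict Implicit. Unset Printing Implicit Defensive.
Import Order.TTheory GRing.Theory Num.Theory.
Local Open Scope ring_scope.
Local Open Scope classical_set_scope.

(** Conjugation by theta = diag(1, -1) realises tau on Sp(2n, R).  An element of
    Gamma(4m) fixing a point of the Siegel space is an isometry of a positive
    definite form on R^2n congruent to 1 modulo 4m >= 4, hence trivial.  So if
    gamma Z = tau(Z) with gamma in Gamma(4m), then gamma is a cocycle, and
    theta gamma is an integral antisymplectic involution congruent to theta
    modulo 4.  The projections onto its eigenspaces are therefore integral and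
    split Z^2n into two dual Lagrangian sublattices; a symplectic basis adapted
    to them, congruent to the standard one modulo 2, is a g in Gamma_2m(2) with
    gamma = tau(g) g^-1.  Then g^-1 Z is fixed by tau, i.e. lies in i C_n.  Finally, two
    points g iY and g' iY' lie in one Gamma(4m)-orbit only if the cocycles of g
    and g' are cohomologous through some h, i.e. if g^-1 h^-1 g' is fixed by tau,
    which for elements of Gamma_2m(2) means that it belongs to Gamma_l(2). *)

(** * Isometries of a positive definite form *)

Section Quadratic.
Variables (R : realType) (p : nat) (Q : 'M[R]_p).
Hypothesis Qsym : Q^T = Q.
Hypothesis Qpos : forall v : 'rV[R]_p, v != 0 -> 0 < (v *m Q *m v^T) 0 0.

Let b (u v : 'rV[R]_p) : R := (u *m Q *m v^T) 0 0.

Let bC u v : b u v = b v u.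
Proof.
by rewrite /b -[in RHS]Qsym -[v in RHS]trmxK -mulmxA -!trmx_mul [in RHS]mxE mulmxA.
Qed.

Let bDl u v w : b (u + v) w = b u w + b v w.
Proof. by rewrite /b !mulmxDl mxE. Qed.

Let bZl c u w : b (c *: u) w = c * b u w.
Proof. by rewrite /b -!scalemxAl mxE. Qed.

Let bDr u v w : b w (u + v) = b w u + b w v.
Proof. by rewrite bC bDl !(bC w). Qed.

Let bZr c u w : b w (c *: u) = c * b w u.
Proof. by rewrite bC bZl bC. Qed.

Let b_ge0 u : 0 <= b u u.
Proof.
have [->|/Qpos/ltW//] := eqVneq u 0.
by rewrite /b !mul0mx mxE.
Qed.

Let b_eq0 u : b u u = 0 -> u = 0.
Proof. by have [//|/Qpos] := eqVneq u 0; rewrite -/(b u u) => + ub; rewrite ub ltxx. Qed.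

Lemma form_Cauchy_Schwarz u v : b u v ^+ 2 <= b u u * b v v.
Proof.
have [->|v0] := eqVneq v 0.
  by rewrite /b trmx0 !mulmx0 mxE expr0n mulr0.
have D0 : 0 < b v v by exact: Qpos.
(* The form takes the value b(v,v) (b(u,u) b(v,v) - b(u,v)^2) at this vector. *)
have := b_ge0 (b v v *: u + (- b u v) *: v).
rewrite !(bDl, bDr, bZl, bZr) (bC v u) => h.
rewrite -subr_ge0 -(pmulr_rge0 _ D0); move: h; congr (0 <= _); ring.
Qed.

Lemma posform_unitmx : Q \in unitmx.
Proof.
rewrite unitmxE unitfE; apply/negP => /det0P[v v0 vQ].
by have := Qpos v0; rewrite vQ mul0mx mxE ltxx.
Qed.

(** Write g = 1 + N B with B integral. Invariance of the form makes B contract it, so the powers of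
    B tend to 0 and, being integral, vanish eventually. A unipotent isometry of a definite form is
    trivial, so B = 0. *)
Lemma congruent_isometry_eq1 (N : nat) (g : 'M[R]_p) :
  (4 <= N)%N -> g *m Q *m g^T = Q -> congrmx N g 1%:M -> g = 1%:M.
Proof.
move=> N4 gQ cg.
have N0 : (N%:R : R) != 0 by rewrite pnatr_eq0 -lt0n (leq_trans _ N4).
pose B := N%:R^-1 *: (g - 1%:M).
have gE : g = 1%:M + N%:R *: B by rewrite scalerA divff // scale1r addrC subrK.
have iso u v : b (u *m g) (v *m g) = b u v.
  by rewrite /b trmx_mul !mulmxA -(mulmxA u) -(mulmxA u) gQ.
have ugE u : u *m g = u + N%:R *: (u *m B).
  by rewrite gE mulmxDr mulmx1 scalemxAr.
have Bint : intmx B.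
  by move=> i j; rewrite /B; have := cg i j; rewrite !mxE mulrC.
(* Invariance at u gives 2N b(u,uB) = -N^2 b(uB,uB). The vector 2u + N uB is u + ug, and
   nonnegativity of the form there becomes N^2 b(uB,uB) <= 4 b(u,u); then N >= 4 gives the factor
   4. *)
have contr u : 4 * b (u *m B) (u *m B) <= b u u.
  have := iso u u; rewrite ugE !(bDl, bDr, bZl, bZr) (bC (u *m B) u).
  have := b_ge0 (2 *: u + N%:R *: (u *m B)).
  rewrite !(bDl, bDr, bZl, bZr) (bC (u *m B) u).
  have NR : 4 <= N%:R :> R by rewrite ler_nat.
  have := b_ge0 (u *m B).
  move: (b (u *m B) (u *m B)) (b u u) (b u (u *m B)) (N%:R : R) NR => x y z t t4 x0 h1 h2.
  have : 4 * t * z = - (2 * t ^+ 2 * x) by lra.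
  have : 16 * x <= t ^+ 2 * x by apply: ler_wpM2r => //; nra.
  by lra.
have contrk k u : 4 ^+ k * b (u *m B ^+ k) (u *m B ^+ k) <= b u u.
  elim: k => [|k IH]; first by rewrite !expr0 mul1r mulmx1.
  apply: le_trans IH; rewrite exprSr -mulrA exprSr -mulmxE !mulmxA.
  by apply: ler_wpM2l; rewrite ?exprn_ge0.
have Bkint k : intmx (B ^+ k).
  elim: k => [|k IH] i j.
    by rewrite expr0 mxE rpred_nat.
  by rewrite exprS -mulmxE mxE rpred_sum // => l _; rewrite rpredM.
(* The vectors [w j] represent the coordinate functions with respect to b. By Cauchy-Schwarz the
   square of each entry of B^k is at most S / 4^k, which is below 1 for the chosen k, and an integer
   of absolute value below 1 is 0. *)
have nilp : exists k, B ^+ k.+1 = 0.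
  pose w (j : 'I_p) := delta_mx (0 : 'I_1) j *m (invmx Q).
  have bw u j : b u (w j) = u 0 j.
    rewrite /b /w trmx_mul trmx_inv Qsym mulmxA mulmxK ?posform_unitmx //.
    by rewrite trmx_delta -colE mxE.
  pose d (i : 'I_p) := delta_mx (0 : 'I_1) i : 'rV[R]_p.
  pose F i j := b (d i) (d i) * b (w j) (w j).
  have F0 i j : 0 <= F i j by rewrite mulr_ge0.
  pose S := \sum_i \sum_j F i j.
  have FS i j : F i j <= S.
    rewrite /S (bigD1 i) //= (bigD1 j) //= -addrA lerDl addr_ge0 ?sumr_ge0 // => k _.
    by rewrite sumr_ge0.
  have S0 : 0 <= S by apply: sumr_ge0 => i _; apply: sumr_ge0.
  exists (Num.bound S).
  set k := (Num.bound S).+1.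
  have Sk : S < 4 ^+ k.
    apply: lt_le_trans (archi_boundP S0) _.
    rewrite -natrX ler_nat; apply: ltnW; apply: ltn_trans (ltn_expl _ _) => //.
  apply/matrixP => i j; rewrite [RHS]mxE; apply/eqP.
  apply: contraT => /(norm_intr_ge1 (Bkint k i j)) h3.
  have := form_Cauchy_Schwarz (d i *m B ^+ k) (w j).
  rewrite bw -rowE mxE => h1.
  have h2 := contrk k (d i); rewrite -rowE in h2.
  have e : 4 ^+ k * (B ^+ k) i j ^+ 2 <= S.
    apply: le_trans (FS i j).
    apply: (le_trans (ler_wpM2l (exprn_ge0 k (ler0n R 4)) h1)).
    by rewrite mulrA ler_wpM2r.
  have : 4 ^+ k * 1 <= 4 ^+ k * (B ^+ k) i j ^+ 2.
    by rewrite ler_wpM2l ?exprn_ge0 // -[X in _ <= X]ger0_norm ?sqr_ge0 // normrX exprn_ege1.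
  by rewrite mulr1 => /le_trans/(_ e); rewrite leNgt Sk.
(* Here u B^2 = 0, so u, ug and ug^2 are u + jN uB for j = 0, 1, 2. The form is a quadratic
   polynomial in j with three equal values, hence its leading coefficient N^2 b(uB,uB) vanishes. *)
have desc k : B ^+ k.+2 = 0 -> B ^+ k.+1 = 0.
  move=> Bk; apply/row_matrixP => i; rewrite row0 rowE exprSr -mulmxE mulmxA.
  set u := _ *m B ^+ k.
  have uBB : u *m B *m B = 0.
    by rewrite -mulmxA mulmxE -expr2 /u -mulmxA mulmxE -exprD addn2 Bk mulmx0.
  apply: b_eq0.
  have h1 := iso u u; rewrite ugE in h1.
  have h2 := iso (u *m g) (u *m g); rewrite !ugE mulmxDl -scalemxAl uBB scaler0 addr0 in h2.
  move: h1 h2; rewrite !(bDl, bDr, bZl, bZr) (bC (u *m B) u) => h1 h2.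
  have : N%:R ^+ 2 * b (u *m B) (u *m B) = 0 by lra.
  by move/eqP; rewrite mulf_eq0 expf_eq0 (negPf N0) => /eqP.
suff B0 : B = 0 by rewrite gE B0 scaler0 addr0.
have [k] := nilp; elim: k => [|k IH /desc //]; by rewrite expr1.
Qed.

End Quadratic.

(** * The symplectic group and the Siegel space *)

Section Symplectic.
Context {R : realType} {n : nat}.
Implicit Types g h : 'M[R]_(n + n).
Local Notation J := (@Jmx R n).

Definition thetamx : 'M[R]_(n + n) := block_mx 1%:M 0 0 (- 1%:M).
Local Notation theta := thetamx.

Lemma trJ : J^T = - J.
Proof. by rewrite /Jmx tr_block_mx opp_block_mx !linear0 linearN /= trmx1 opprK. Qed.

Lemma JJ : J *m J = - 1%:M.
Proof.
rewrite /Jmx mulmx_block !(mul0mx, mulmx0, mulmx1, mul1mx, add0r, addr0, mulNmx).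
by rewrite [in RHS]scalar_mx_block opp_block_mx !oppr0.
Qed.

Lemma thetaK : theta *m theta = 1%:M.
Proof.
rewrite /theta mulmx_block.
rewrite !(mul0mx, mulmx0, mulmx1, mul1mx, add0r, addr0, mulNmx, mulmxN, opprK, oppr0).
by rewrite -scalar_mx_block.
Qed.

Lemma trtheta : theta^T = theta.
Proof. by rewrite /theta tr_block_mx !linear0 linearN /= trmx1. Qed.

Lemma thetaJ : theta *m J *m theta = - J.
Proof.
rewrite /theta /Jmx !mulmx_block.
rewrite !(mul0mx, mulmx0, mulmx1, mul1mx, add0r, addr0, mulNmx, mulmxN, opprK, oppr0).
by rewrite opp_block_mx oppr0 opprK.
Qed.

Lemma tauE g : tau g = theta *m g *m theta.
Proof.
rewrite /tau /theta -[g in RHS]submxK !mulmx_block.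
by rewrite !(mul0mx, mulmx0, mulmx1, mul1mx, add0r, addr0, mulNmx, mulmxN, opprK, oppr0).
Qed.

Lemma tauM g h : tau (g *m h) = tau g *m tau h.
Proof. by rewrite !tauE !mulmxA -(mulmxA _ theta theta) thetaK mulmx1. Qed.

Lemma tauK g : tau (tau g) = g.
Proof. by rewrite !tauE !mulmxA thetaK mul1mx -mulmxA thetaK mulmx1. Qed.

Lemma tau1 : tau 1%:M = 1%:M :> 'M[R]_(n + n).
Proof. by rewrite tauE mulmx1 thetaK. Qed.

Lemma Sp_mulJV g : Sp g -> g *m (- (J *m g^T *m J)) = 1%:M.
Proof.
move=> gS; apply: mulmx1C; rewrite mulNmx.
have -> : J *m g^T *m J *m g = J *m (g^T *m J *m g) by rewrite !mulmxA.
by rewrite gS JJ opprK.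
Qed.

Lemma Sp_unit g : Sp g -> g \in unitmx.
Proof. by move=> /Sp_mulJV/mulmx1_unit[]. Qed.

(** A formula free of division: it shows that the inverse of an integral symplectic matrix is
    integral. *)
Lemma Sp_inv g : Sp g -> invmx g = - (J *m g^T *m J).
Proof.
move=> gS; apply: (can_inj (mulKmx (Sp_unit gS))).
by rewrite mulmxV ?Sp_unit // Sp_mulJV.
Qed.

Lemma SpM g h : Sp g -> Sp h -> Sp (g *m h).
Proof.
rewrite /Sp /= => gS hS; rewrite trmx_mul !mulmxA -(mulmxA _ _ J) -(mulmxA _ _ g).
by rewrite gS.
Qed.

Lemma SpV g : Sp g -> Sp (invmx g).
Proof.
move=> gS; have gu := Sp_unit gS; rewrite /Sp /= -{1}gS !mulmxA.
by rewrite trmx_inv mulVmx ?unitmx_tr // mul1mx mulmxK.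
Qed.

Lemma Sp1 : @Sp R n 1%:M.
Proof. by rewrite /Sp /= trmx1 mulmx1 mul1mx. Qed.

Lemma Sp_tau g : Sp g -> Sp (tau g).
Proof.
rewrite /Sp /= tauE !trmx_mul trtheta !mulmxA => gS.
have -> : theta *m g^T *m theta *m J *m theta *m g *m theta
  = theta *m g^T *m (theta *m J *m theta) *m g *m theta by rewrite !mulmxA.
rewrite thetaJ mulmxN !mulNmx.
have -> : theta *m g^T *m J *m g *m theta = theta *m (g^T *m J *m g) *m theta.
  by rewrite !mulmxA.
by rewrite gS thetaJ opprK.
Qed.

Lemma tauV g : Sp g -> tau (invmx g) = invmx (tau g).
Proof.
move=> gS; have gu := Sp_unit (Sp_tau gS).
rewrite -[LHS]mulmx1 -(mulmxV gu) mulmxA -tauM mulVmx ?tau1 ?mul1mx //.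
exact: Sp_unit.
Qed.

Lemma invmxM (K : comUnitRingType) p (A B : 'M[K]_p) : A \in unitmx -> B \in unitmx ->
  invmx (A *m B) = invmx B *m invmx A.
Proof.
move=> Au Bu; have ABu : A *m B \in unitmx by rewrite unitmx_mul Au Bu.
apply: (can_inj (mulKmx ABu)); rewrite mulmxV //.
by rewrite !mulmxA mulmxK // mulmxV.
Qed.

End Symplectic.

(** * Lagrangian frames and the action on the Siegel space *)

Section SiegelSpace.
Context {R : realType} {n : nat}.
Local Notation C := R[i].
Local Notation J := (@Jmx R n).
Implicit Types (g h : 'M[R]_(n + n)) (Z : 'M[C]_n).

Definition adjmx p q (A : 'M[C]_(p, q)) : 'M[C]_(q, p) := (map_mx (@conjc R) A)^T.

Lemma adjmxM p q r (A : 'M[C]_(p, q)) (B : 'M[C]_(q, r)) :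
  adjmx (A *m B) = adjmx B *m adjmx A.
Proof. by rewrite /adjmx map_mxM trmx_mul. Qed.

Lemma adjmxK p q (A : 'M[C]_(p, q)) : adjmx (adjmx A) = A.
Proof. by apply/matrixP=> i j; rewrite !mxE conjcK. Qed.

Lemma adj_toC p q (A : 'M[R]_(p, q)) : adjmx (toC A) = toC A^T.
Proof. by apply/matrixP=> i j; rewrite !mxE conjc_real. Qed.

Lemma adj_col p1 p2 q (A : 'M[C]_(p1, q)) (B : 'M[C]_(p2, q)) :
  adjmx (col_mx A B) = row_mx (adjmx A) (adjmx B).
Proof. by rewrite /adjmx map_col_mx tr_col_mx. Qed.

Lemma adj_unitmx p (A : 'M[C]_p) : (adjmx A \in unitmx) = (A \in unitmx).
Proof. by rewrite /adjmx unitmx_tr map_unitmx. Qed.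

Lemma adj_inv p (A : 'M[C]_p) : adjmx (invmx A) = invmx (adjmx A).
Proof. by rewrite /adjmx map_invmx trmx_inv. Qed.

Lemma toCM p q r (A : 'M[R]_(p, q)) (B : 'M[R]_(q, r)) : toC (A *m B) = toC A *m toC B.
Proof. exact: (map_mxM (real_complex R)). Qed.

Lemma toCD p q (A B : 'M[R]_(p, q)) : toC (A + B) = toC A + toC B.
Proof. exact: (map_mxD (real_complex R)). Qed.

Lemma toC0 p q : toC (0 : 'M[R]_(p, q)) = 0.
Proof. exact: (map_mx0 (real_complex R)). Qed.

Lemma toC1 p : toC (1%:M : 'M[R]_p) = 1%:M.
Proof. exact: (map_mx1 (real_complex R)). Qed.

Lemma toCI p q (A B : 'M[R]_(p, q)) : toC A = toC B -> A = B.
Proof. by move/matrixP=> h; apply/matrixP => i j; have := h i j; rewrite !mxE => -[]. Qed.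

Lemma toC_inv p (A : 'M[R]_p) : toC (invmx A) = invmx (toC A).
Proof. exact: (map_invmx (real_complex R)). Qed.

Lemma toC_unit p (A : 'M[R]_p) : (toC A \in unitmx) = (A \in unitmx).
Proof. exact: (map_unitmx (real_complex R)). Qed.

Lemma toC_block p1 p2 q1 q2 (A : 'M[R]_(p1, q1)) (B : 'M[R]_(p1, q2))
  (D : 'M[R]_(p2, q1)) (E : 'M[R]_(p2, q2)) :
  toC (block_mx A B D E) = block_mx (toC A) (toC B) (toC D) (toC E).
Proof. exact: map_block_mx. Qed.

Lemma Re_Im_mx p q (A : 'M[C]_(p, q)) :
  A = toC (map_mx (@complex.Re R) A) + ('i)%C *: toC (map_mx (@complex.Im R) A).
Proof. by apply/matrixP => i j; rewrite !mxE -complexE. Qed.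

(** For x = a + ib the cross terms cancel by the symmetry of Y, which leaves the sum of the real
    form at a and at b. *)
Lemma posdef_complex p (Y : 'M[R]_p) (x : 'cV[C]_p) :
  Y^T = Y -> posdef Y -> x != 0 -> 0 < (adjmx x *m toC Y *m x) 0 0.
Proof.
move=> Ysym Ypos x0.
pose a := map_mx (@complex.Re R) x; pose b := map_mx (@complex.Im R) x.
have xE : x = toC a + ('i)%C *: toC b by exact: Re_Im_mx.
have axE : adjmx x = toC a^T - ('i)%C *: toC b^T.
  by apply/matrixP => i j; rewrite !mxE; case: (x j i) => u v; simpc; rewrite /= ?oppr0.
have qE (u v : 'cV[R]_p) : toC u^T *m toC Y *m toC v = toC (u^T *m Y *m v).
  by rewrite !toCM.
have sy : (b^T *m Y *m a) = (a^T *m Y *m b).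
  apply/matrixP => i j; rewrite !ord1; have -> : b^T *m Y *m a = (a^T *m Y *m b)^T.
    by rewrite !trmx_mul trmxK Ysym mulmxA.
  by rewrite mxE.
have -> : adjmx x *m toC Y *m x = toC (a^T *m Y *m a + b^T *m Y *m b).
  rewrite axE {axE} xE {xE} !mulmxDl !mulmxDr !mulNmx -!scalemxAl -!scalemxAr !qE sy toCD.
  rewrite scalerA -expr2 sqr_i scaleN1r opprK.
  by rewrite addrA addrK.
have ge0 (u : 'cV[R]_p) : 0 <= (u^T *m Y *m u) 0 0.
  have [->|/Ypos/ltW//] := eqVneq u 0.
  by rewrite mulmx0 mxE.
rewrite mxE [X in X%:C%C]mxE (ltcR 0) lt_neqAle addr_ge0 ?ge0 // andbT eq_sym.
rewrite paddr_eq0 ?ge0 //; apply: contra x0 => /andP[/eqP ha /eqP hb].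
have za : a = 0 by apply: contra_eq ha => /Ypos; rewrite lt_neqAle eq_sym => /andP[].
have zb : b = 0 by apply: contra_eq hb => /Ypos; rewrite lt_neqAle eq_sym => /andP[].
by rewrite xE za zb !toC0 scaler0 addr0.
Qed.

(** Its columns span the Lagrangian subspace of C^2n attached to Z. The fractional action of g
    becomes left multiplication on frames, up to the factor of automorphy CZ + D on the right. *)
Definition frame Z : 'M[C]_(n + n, n) := col_mx Z 1%:M.

Definition autfac g Z : 'M[C]_n := toC (dlsubmx g) *m Z + toC (drsubmx g).

Lemma mul_frame g Z :
  toC g *m frame Z = col_mx (toC (ulsubmx g) *m Z + toC (ursubmx g)) (autfac g Z).
Proof. by rewrite -{1}[g]submxK toC_block mul_block_col !mulmx1. Qed.

Lemma act_frame g Z : autfac g Z \in unitmx ->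
  toC g *m frame Z = frame (act g Z) *m autfac g Z.
Proof. by move=> Uu; rewrite mul_frame mul_col_mx mul1mx mulmxKV. Qed.

Lemma frame_act g Z Z' U : U \in unitmx -> toC g *m frame Z = frame Z' *m U ->
  act g Z = Z'.
Proof.
move=> Uu; rewrite mul_frame mul_col_mx mul1mx => /eq_col_mx[e1 e2].
by rewrite /act -/(autfac g Z) e1 e2 mulmxK.
Qed.

Lemma toC_J : toC J = block_mx 0 1%:M (- 1%:M) 0.
Proof.
rewrite toC_block !toC0 toC1; congr block_mx.
by rewrite -toC1 [LHS](map_mxN (real_complex R)).
Qed.

Lemma row_J_col q r (A1 A2 : 'M[C]_(q, n)) (B1 B2 : 'M[C]_(n, r)) :
  row_mx A1 A2 *m toC J *m col_mx B1 B2 = A1 *m B2 - A2 *m B1.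
Proof.
rewrite toC_J mul_row_block !(mulmx0, mulmx1, mulmxN, add0r, addr0) mul_row_col.
by rewrite mulNmx addrC.
Qed.

(** Im Z is thus, up to a scalar, the Hermitian form of J on the frame. Since Sp(2n, R) preserves
    that form, it controls both the invertibility of CZ + D and the positivity of Im gZ. *)
Lemma frame_herm Z : Z^T = Z ->
  adjmx (frame Z) *m toC J *m frame Z = - (2 * 'i)%C *: toC (map_mx (@complex.Im R) Z).
Proof.
move=> Zs; rewrite adj_col row_J_col mulmx1.
have -> : adjmx (1%:M : 'M[C]_n) = 1%:M by rewrite -toC1 adj_toC trmx1.
rewrite mul1mx /adjmx map_trmx Zs; apply/matrixP => i j; rewrite !mxE.
case: (Z i j) => a b /=; rewrite -complexr0.
apply/eqP; rewrite eq_complex /=; apply/andP; split; apply/eqP; ring.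
Qed.

Lemma Sp_toC g : Sp g -> toC g^T *m toC J *m toC g = toC J.
Proof. by move=> gS; rewrite -!toCM gS. Qed.

Lemma frame_herm_act g Z : Sp g -> hn Z ->
  adjmx (toC g *m frame Z) *m toC J *m (toC g *m frame Z)
  = - (2 * 'i)%C *: toC (map_mx (@complex.Im R) Z).
Proof.
move=> gS hZ; rewrite -(frame_herm hZ.1) adjmxM adj_toC !mulmxA.
by rewrite -(mulmxA _ _ (toC J)) -(mulmxA _ _ (toC g)) Sp_toC.
Qed.

Lemma hn_Im_sym Z : hn Z -> (map_mx (@complex.Im R) Z)^T = map_mx (@complex.Im R) Z.
Proof. by move=> [Zs _]; rewrite map_trmx Zs. Qed.

(** If x is a kernel vector of CZ + D, the lower half of g F x vanishes, so g F x is isotropic for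
    the Hermitian form of J. By invariance x is then isotropic for Im Z, against definiteness. *)
Lemma autfac_unit g Z : Sp g -> hn Z -> autfac g Z \in unitmx.
Proof.
move=> gS hZ; rewrite -unitmx_tr unitmxE unitfE; apply/negP => /det0P[v v0 vU].
have x0 : v^T != 0 by rewrite -trmx0 (inj_eq trmx_inj).
have Ux : autfac g Z *m v^T = 0 by rewrite -[LHS]trmxK trmx_mul trmxK vU trmx0.
have := posdef_complex (hn_Im_sym hZ) hZ.2 x0.
set x := v^T in x0 Ux *.
have : adjmx (toC g *m frame Z *m x) *m toC J *m (toC g *m frame Z *m x) = 0.
  rewrite mul_frame mul_col_mx Ux adj_col row_J_col mulmx0.
  by rewrite {1}/adjmx map_mx0 trmx0 mul0mx subrr.
have -> : adjmx (toC g *m frame Z *m x) *m toC J *m (toC g *m frame Z *m x)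
  = adjmx x *m (adjmx (toC g *m frame Z) *m toC J *m (toC g *m frame Z)) *m x.
  by rewrite (adjmxM _ x) !mulmxA.
rewrite frame_herm_act // -scalemxAr -scalemxAl => /eqP.
rewrite scaler_eq0 oppr_eq0 mulf_eq0 pnatr_eq0 /= => /orP[|/eqP ->].
  by rewrite eq_complex /= oner_eq0 andbF.
by rewrite mxE ltxx.
Qed.

Lemma frame_bilin Z : Z^T = Z -> (frame Z)^T *m toC J *m frame Z = 0.
Proof. by move=> Zs; rewrite tr_col_mx row_J_col trmx1 mulmx1 mul1mx Zs subrr. Qed.

(** Evaluate the Hermitian form of J on g F(Z) = F(gZ) U in two ways. The symmetry of gZ is assumed
    because [hn_act] uses this identity to obtain positivity. *)
Lemma ImactE g Z : Sp g -> hn Z -> (act g Z)^T = act g Z ->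
  adjmx (autfac g Z) *m toC (map_mx (@complex.Im R) (act g Z)) *m autfac g Z
  = toC (map_mx (@complex.Im R) Z).
Proof.
move=> gS hZ sym.
have := frame_herm_act gS hZ; rewrite act_frame ?autfac_unit //.
have -> : adjmx (frame (act g Z) *m autfac g Z) *m toC J *m (frame (act g Z) *m autfac g Z)
 = adjmx (autfac g Z) *m (adjmx (frame (act g Z)) *m toC J *m frame (act g Z)) *m autfac g Z.
  by rewrite adjmxM !mulmxA.
rewrite (frame_herm sym) -scalemxAr -scalemxAl; apply: scalerI.
rewrite oppr_eq0 mulf_eq0 pnatr_eq0 /=.
by rewrite eq_complex /= oner_eq0 andbF.
Qed.

(** The bilinear form of J vanishes on F(Z), hence on F(gZ), and this vanishing is the symmetry of
    gZ. Positivity is transported by [ImactE]. *)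
Lemma hn_act g Z : Sp g -> hn Z -> hn (act g Z).
Proof.
move=> gS hZ; have Uu := autfac_unit gS hZ.
have sym : (act g Z)^T = act g Z.
  have : (toC g *m frame Z)^T *m toC J *m (toC g *m frame Z) = 0.
    have -> : (toC g *m frame Z)^T *m toC J *m (toC g *m frame Z)
      = (frame Z)^T *m (toC g^T *m toC J *m toC g) *m frame Z.
      by rewrite trmx_mul !mulmxA /toC map_trmx.
    by rewrite Sp_toC // frame_bilin // hZ.1.
  rewrite act_frame // trmx_mul.
  have -> (A : 'M[C]_n) F : A *m F^T *m toC J *m (F *m autfac g Z)
    = A *m (F^T *m toC J *m F) *m autfac g Z by rewrite !mulmxA.
  rewrite tr_col_mx row_J_col trmx1 mulmx1 mul1mx.
  move/(congr1 (fun M => invmx (autfac g Z)^T *m M *m invmx (autfac g Z))).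
  rewrite mulmx0 mul0mx !mulmxA mulVmx ?unitmx_tr // mul1mx mulmxK //.
  by move/eqP; rewrite subr_eq0 => /eqP.
split=> // v v0.
have := ImactE gS hZ sym; set U := autfac g Z in Uu *.
set Y' := map_mx _ (act g Z) => e.
have w0 : invmx U *m toC v != 0.
  apply: contra v0 => /eqP/(congr1 (mulmx U)); rewrite mulKVmx // mulmx0 -(toC0 n 1).
  by move/toCI=> ->.
have := posdef_complex (hn_Im_sym hZ) hZ.2 w0.
rewrite -e adjmxM adj_inv adj_toC !mulmxA mulmxKV ?adj_unitmx //.
rewrite mulmxK // -!toCM [X in _ < X -> _]mxE.
by rewrite (ltcR 0).
Qed.

Lemma actM g h Z : Sp g -> Sp h -> hn Z -> act (g *m h) Z = act g (act h Z).
Proof.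
move=> gS hS hZ; have hZ' := hn_act hS hZ.
apply: (@frame_act _ _ _ (autfac g (act h Z) *m autfac h Z)).
  by rewrite unitmx_mul !autfac_unit.
by rewrite toCM -mulmxA act_frame ?autfac_unit // mulmxA act_frame ?autfac_unit // mulmxA.
Qed.

Lemma act1 Z : act 1%:M Z = Z.
Proof. by apply: (@frame_act _ _ _ 1%:M); rewrite ?unitmx1 // toC1 mul1mx mulmx1. Qed.

End SiegelSpace.

(** * The involution tau *)

Section Involution.
Context {R : realType} {n : nat}.
Local Notation C := R[i].
Implicit Types (g h k : 'M[R]_(n + n)) (Z : 'M[C]_n) (A Y : 'M[R]_n).

Lemma tauZK Z : tauZ (tauZ Z) = Z.
Proof.
apply/matrixP => i j; rewrite !mxE; by case: (Z i j) => a b; simpc.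
Qed.

Lemma hn_tauZ Z : hn Z -> hn (tauZ Z).
Proof.
move=> [Zs Zp]; split; first by rewrite /tauZ linearN /= map_trmx Zs.
have -> : map_mx (@complex.Im R) (tauZ Z) = map_mx (@complex.Im R) Z; last by [].
by apply/matrixP => i j; rewrite !mxE; case: (Z i j) => a b /=; rewrite opprK.
Qed.

Lemma frame_tauZ Z :
  frame (tauZ Z) = - (toC thetamx *m map_mx (@conjc R) (frame Z)).
Proof.
rewrite /frame map_col_mx map_mx1 toC_block mul_block_col !toC0 !mul0mx toC1.
rewrite mul1mx addr0 add0r [toC (- _)](map_mxN (real_complex R)) map_mx1.
by rewrite mulmx1 opp_col_mx opprK.
Qed.

(** On frames tau is complex conjugation followed by -theta. Conjugation commutes with the real
    matrix g, and moving theta across g turns g into tau(g). *)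
Lemma tauZ_act g Z : Sp g -> hn Z -> tauZ (act g Z) = act (tau g) (tauZ Z).
Proof.
move=> gS hZ; have Uu := autfac_unit gS hZ.
symmetry; apply: (@frame_act _ _ _ _ _ (map_mx (@conjc R) (autfac g Z))).
  by rewrite map_unitmx.
rewrite !frame_tauZ mulNmx -mulmxA -map_mxM -act_frame // map_mxM.
have -> : map_mx (@conjc R) (toC g) = toC g.
  by apply/matrixP => i j; rewrite !mxE conjc_real.
rewrite tauE !toCM mulmxN !mulmxA -(mulmxA _ (toC thetamx) (toC thetamx)).
by rewrite -(toCM thetamx thetamx) thetaK toC1 mulmx1.
Qed.

Lemma hn_iY Y : Cn Y -> hn (iY Y).
Proof.
move=> [Ys Yp]; split; first by rewrite /iY map_trmx Ys.
by have -> : map_mx (@complex.Im R) (iY Y) = Y by apply/matrixP => i j; rewrite !mxE.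
Qed.

Lemma tauZ_iY Y : tauZ (iY Y) = iY Y.
Proof. by apply/matrixP => i j; rewrite !mxE; simpc. Qed.

Lemma tauZ_fixed Z : hn Z -> tauZ Z = Z -> exists2 Y, Cn Y & Z = iY Y.
Proof.
move=> hZ tZ; exists (map_mx (@complex.Im R) Z).
  by split; [exact: hn_Im_sym | exact: hZ.2].
apply/matrixP => i j; move/matrixP/(_ i j): tZ; rewrite !mxE.
case: (Z i j) => a b /= [/eqP]; rewrite -subr_eq0 -opprD oppr_eq0 -mulr2n mulrn_eq0 /=.
by move/eqP => ->.
Qed.

Lemma embGL_Sp A : A \in unitmx -> Sp (embGL A).
Proof.
move=> Au; rewrite /Sp /= /embGL /Jmx tr_block_mx !mulmx_block.
rewrite !trmx0 !(mul0mx, mulmx0, mulmx1, mul1mx, add0r, addr0, mulNmx, mulmxN).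
rewrite mulmxV ?unitmx_tr // trmx_inv trmxK mulVmx //.
Qed.

Lemma iYE Y : iY Y = ('i)%C *: toC Y.
Proof. by apply/matrixP => i j; rewrite !mxE; simpc. Qed.

Lemma act_embGL A Y : A \in unitmx -> act (embGL A) (iY Y) = iY (A *m Y *m A^T).
Proof.
move=> Au; apply: (@frame_act _ _ _ _ _ (toC (invmx A^T))).
  by rewrite toC_unit unitmx_inv unitmx_tr.
rewrite /embGL toC_block /frame mul_block_col !toC0 mul0mx mulmx1 addr0 mul0mx add0r.
rewrite mul_col_mx mul1mx !iYE -scalemxAl -scalemxAr -!toCM; congr (col_mx (_ *: toC _) _).
by rewrite mulmxK ?unitmx_tr.
Qed.

Lemma Cn_congr A Y : A \in unitmx -> Cn Y -> Cn (A *m Y *m A^T).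
Proof.
move=> Au [Ys Yp]; split; first by rewrite !trmx_mul trmxK Ys mulmxA.
move=> v v0; have w0 : A^T *m v != 0.
  apply: contra v0 => /eqP/(congr1 (mulmx (invmx A^T))).
  by rewrite mulKmx ?unitmx_tr // mulmx0 => ->.
by have := Yp _ w0; rewrite trmx_mul trmxK !mulmxA.
Qed.

(** The off-diagonal blocks equal their opposites, so they vanish; the symplectic relation then
    reads A^T D = 1. *)
Lemma tau_fixed k : Sp k -> tau k = k ->
  ulsubmx k \in unitmx /\ k = embGL (ulsubmx k).
Proof.
move=> kS; rewrite /tau -{5}[k]submxK => /eq_block_mx[_ hB hC _].
have z (M : 'M[R]_n) : - M = M -> M = 0.
  move=> hM; apply/matrixP => i j; move/matrixP/(_ i j): hM; rewrite !mxE => /eqP.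
  by rewrite -subr_eq0 -opprD oppr_eq0 -mulr2n mulrn_eq0 /= => /eqP.
move: kS; rewrite -[k]submxK (z _ hB) (z _ hC) /Sp /= /Jmx tr_block_mx !mulmx_block.
rewrite !trmx0 !(mul0mx, mulmx0, mulmx1, mul1mx, add0r, addr0, mulNmx, mulmxN).
move=> /eq_block_mx[_ h _ _]; rewrite block_mxKul.
have [] := mulmx1_unit h; rewrite unitmx_tr => Au _; split=> //.
rewrite /embGL; congr block_mx.
have Atu : (ulsubmx k)^T \in unitmx by rewrite unitmx_tr.
by apply: (can_inj (mulKmx Atu)); rewrite h mulmxV.
Qed.

Lemma Re_mxD p q (X Y : 'M[R]_(p, q)) :
  map_mx (@complex.Re R) (toC X + ('i)%C *: toC Y) = X.
Proof. by apply/matrixP => i j; rewrite !mxE; simpc => /=; rewrite ?addr0 ?subr0. Qed.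

Lemma Im_mxD p q (X Y : 'M[R]_(p, q)) :
  map_mx (@complex.Im R) (toC X + ('i)%C *: toC Y) = Y.
Proof. by apply/matrixP => i j; rewrite !mxE; simpc => /=; rewrite ?addr0 ?add0r. Qed.

Lemma Re_mul_toC p q r s (A : 'M[R]_(p, q)) (M : 'M[C]_(q, r)) (B : 'M[R]_(r, s)) :
  map_mx (@complex.Re R) (toC A *m M *m toC B) = A *m map_mx (@complex.Re R) M *m B.
Proof.
rewrite {1}[M]Re_Im_mx mulmxDr mulmxDl -scalemxAr -scalemxAl -!toCM.
exact: Re_mxD.
Qed.

(* The stabiliser of Z preserves the positive definite form Re (F Y^-1 F^* ),
   where F is the frame of Z and Y its imaginary part. *)
Lemma congr_fixed_point_eq1 N g Z : (4 <= N)%N -> Sp g -> hn Z ->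
  congrmx N g 1%:M -> act g Z = Z -> g = 1%:M.
Proof.
move=> N4 gS hZ cg fZ.
have Uu := autfac_unit gS hZ.
have gF := act_frame Uu; rewrite fZ in gF.
have UY := ImactE gS hZ; rewrite fZ in UY; have {UY} := UY hZ.1.
set U := autfac g Z in Uu gF *; set F := frame Z in gF *.
set Y := map_mx _ Z => UY.
have Ys : Y^T = Y by exact: hn_Im_sym.
have Yp : posdef Y by exact: hZ.2.
have Yu : Y \in unitmx.
  apply: (@posform_unitmx R n Y) => v v0; have := Yp v^T; rewrite trmxK; apply.
  by rewrite -trmx0 (inj_eq trmx_inj).
pose Yi := invmx Y.
have Yis : Yi^T = Yi by rewrite /Yi trmx_inv Ys.
have Yip : posdef Yi.
  move=> v v0; have w0 : Yi *m v != 0.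
    by apply: contra v0 => /eqP/(congr1 (mulmx Y)); rewrite mulKVmx // mulmx0 => ->.
  by have := Yp _ w0; rewrite trmx_mul Yis !mulmxA mulmxKV.
(* This is [UY] inverted. Together with g F = F U it gives the invariance of Q under g. *)
have UYi : U *m toC Yi *m adjmx U = toC Yi.
  have YCu : toC Y \in unitmx by rewrite toC_unit.
  have Uau : adjmx U \in unitmx by rewrite adj_unitmx.
  rewrite /Yi toC_inv -{1}UY !invmxM ?unitmx_mul ?Uau ?YCu //.
  by rewrite !mulmxA mulmxV // mul1mx mulmxKV.
pose QC := F *m toC Yi *m adjmx F.
pose Q := map_mx (@complex.Re R) QC.
apply: (@congruent_isometry_eq1 R _ Q _ _ N) => //.
- have : adjmx QC = QC by rewrite /QC !adjmxM adjmxK adj_toC Yis mulmxA.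
  move=> /matrixP h; apply/matrixP => i j; rewrite [LHS]mxE [LHS]mxE [RHS]mxE -h.
  by rewrite !mxE; case: (\sum_j0 _).
- move=> v v0.
  (* For v = (a, b) the product v F is aZ + b. If it vanishes, its imaginary part aY forces a = 0,
     and its real part then forces b = 0. *)
  have x0 : adjmx (toC v *m F) != 0.
    apply: contra v0 => /eqP/(congr1 (@adjmx R _ _)); rewrite adjmxK.
    rewrite [adjmx 0]/adjmx map_mx0 trmx0.
    rewrite -[v]hsubmxK; move: (lsubmx v) (rsubmx v) => a b.
    rewrite [toC (row_mx _ _)]map_row_mx -!/(toC _) mul_row_col mulmx1.
    rewrite {1}[Z]Re_Im_mx -/Y mulmxDr -scalemxAr -!toCM addrAC -toCD => e.
    have := congr1 (map_mx (@complex.Im R)) e; rewrite Im_mxD => aY.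
    have := congr1 (map_mx (@complex.Re R)) e; rewrite Re_mxD => ab.
    have a0 : a = 0.
      rewrite -[a](mulmxK Yu) aY (_ : map_mx _ _ = 0) ?mul0mx //.
      by apply/matrixP => i j; rewrite !mxE.
    rewrite a0 mul0mx add0r in ab.
    by rewrite a0 ab (_ : map_mx _ _ = 0) ?row_mx0 //; apply/matrixP => i j; rewrite !mxE.
  have := posdef_complex Yis Yip x0.
  rewrite adjmxK adjmxM adj_toC !mulmxA.
  rewrite ltcE => /andP[_] /=.
  by rewrite /Q -Re_mul_toC [X in _ -> 0 < X]mxE /QC !mulmxA.
- rewrite /Q -Re_mul_toC /QC -adj_toC !mulmxA -mulmxA -adjmxM gF.
  by rewrite adjmxM !mulmxA -(mulmxA F) -(mulmxA F) UYi.
Qed.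

End Involution.

(** * Congruence subgroups *)

Section Congruences.
Context {R : realType}.

Lemma intmxM p q r (A : 'M[R]_(p, q)) (B : 'M[R]_(q, r)) :
  intmx A -> intmx B -> intmx (A *m B).
Proof. by move=> iA iB i j; rewrite mxE rpred_sum // => k _; rewrite rpredM. Qed.

Lemma intmxD p q (A B : 'M[R]_(p, q)) : intmx A -> intmx B -> intmx (A + B).
Proof. by move=> iA iB i j; rewrite mxE rpredD. Qed.

Lemma intmxN p q (A : 'M[R]_(p, q)) : intmx A -> intmx (- A).
Proof. by move=> iA i j; rewrite mxE rpredN. Qed.

Lemma intmxT p q (A : 'M[R]_(p, q)) : intmx A -> intmx A^T.
Proof. by move=> iA i j; rewrite mxE. Qed.

Lemma intmx_scalar p (a : R) : a \is a Num.int -> intmx (a%:M : 'M_p).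
Proof. by move=> ia i j; rewrite mxE rpredMn. Qed.

Lemma intmx0 p q : intmx (0 : 'M[R]_(p, q)).
Proof. by move=> i j; rewrite mxE rpred0. Qed.

Lemma intmx_block p1 p2 q1 q2 (A : 'M[R]_(p1, q1)) (B : 'M[R]_(p1, q2))
  (C : 'M[R]_(p2, q1)) (D : 'M[R]_(p2, q2)) :
  intmx (block_mx A B C D) <-> [/\ intmx A, intmx B, intmx C & intmx D].
Proof.
split=> [h|[iA iB iC iD] i j].
  split=> i j; [move: (h (lshift _ i) (lshift _ j))
    | move: (h (lshift _ i) (rshift _ j)) | move: (h (rshift _ i) (lshift _ j))
    | move: (h (rshift _ i) (rshift _ j))];
  by rewrite (block_mxEul, block_mxEur, block_mxEdl, block_mxEdr).
by rewrite -(splitK i) -(splitK j); case: (fintype.split i) => i';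
  case: (fintype.split j) => j' /=;
  rewrite (block_mxEul, block_mxEur, block_mxEdl, block_mxEdr).
Qed.

Lemma congrmxE N p q (A B : 'M[R]_(p, q)) :
  congrmx N A B <-> intmx (N%:R^-1 *: (A - B)).
Proof. by split=> h i j; have := h i j; rewrite !mxE mulrC. Qed.

Lemma congrmx_refl N p q (A : 'M[R]_(p, q)) : congrmx N A A.
Proof. by move=> i j; rewrite subrr mul0r rpred0. Qed.

Lemma congrmx_sym N p q (A B : 'M[R]_(p, q)) : congrmx N A B -> congrmx N B A.
Proof. by move=> h i j; rewrite -opprB mulNr rpredN. Qed.

Lemma congrmx_trans N p q (A B C : 'M[R]_(p, q)) :
  congrmx N A B -> congrmx N B C -> congrmx N A C.
Proof.
move=> h1 h2 i j; rewrite -(subrK (B i j) (A i j)) -addrA mulrDl.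
by rewrite rpredD ?h1 ?h2.
Qed.

Lemma congrmxM N p q r (A A' : 'M[R]_(p, q)) (B B' : 'M[R]_(q, r)) :
  intmx A' -> intmx B -> congrmx N A A' -> congrmx N B B' ->
  congrmx N (A *m B) (A' *m B').
Proof.
move=> iA iB /congrmxE hA /congrmxE hB; apply/congrmxE.
have -> : N%:R^-1 *: (A *m B - A' *m B')
  = (N%:R^-1 *: (A - A')) *m B + A' *m (N%:R^-1 *: (B - B')).
  by rewrite -scalemxAl -scalemxAr -scalerDr mulmxBl mulmxBr addrA subrK.
by apply: intmxD; apply: intmxM.
Qed.

Lemma congrmxT N p q (A B : 'M[R]_(p, q)) : congrmx N A B -> congrmx N A^T B^T.
Proof. by move=> h i j; rewrite !mxE. Qed.

Lemma congrmx_dvd d N p q (A B : 'M[R]_(p, q)) :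
  (0 < N)%N -> (d %| N)%N -> congrmx N A B -> congrmx d A B.
Proof.
move=> N0 /dvdnP[k Nk] h i j; have := h i j; rewrite Nk natrM.
move: N0; rewrite Nk muln_gt0 => /andP[k0 d0] hi.
have kR : (k%:R : R) != 0 by rewrite pnatr_eq0 -lt0n.
suff -> : (A i j - B i j) / d%:R = k%:R * ((A i j - B i j) / (k%:R * d%:R)).
  by rewrite rpredM ?rpred_nat.
have dR : (d%:R : R) != 0 by rewrite pnatr_eq0 -lt0n.
by field; rewrite kR dR.
Qed.

Lemma congrmx_block N p1 p2 q1 q2 (A A' : 'M[R]_(p1, q1)) (B B' : 'M[R]_(p1, q2))
  (C C' : 'M[R]_(p2, q1)) (D D' : 'M[R]_(p2, q2)) :
  congrmx N (block_mx A B C D) (block_mx A' B' C' D') <->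
  [/\ congrmx N A A', congrmx N B B', congrmx N C C' & congrmx N D D'].
Proof.
split.
  by move/congrmxE; rewrite opp_block_mx add_block_mx scale_block_mx
    => /intmx_block[? ? ? ?]; split; apply/congrmxE.
move=> [/congrmxE ? /congrmxE ? /congrmxE ? /congrmxE ?]; apply/congrmxE.
by rewrite opp_block_mx add_block_mx scale_block_mx; apply/intmx_block.
Qed.

End Congruences.
#[local] Hint Resolve congrmx_refl : core.

(** * The groups Gamma(N), Gamma_2m(2) and Gamma_l(N) *)

Section Groups.
Context {R : realType} {n : nat}.
Implicit Types (g h k : 'M[R]_(n + n)).

Lemma int_theta : intmx (@thetamx R n).
Proof.
apply/intmx_block; split; try exact: intmx0.
- exact: intmx_scalar.
- by apply: intmxN; apply: intmx_scalar.
Qed.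

Lemma int_J : intmx (@Jmx R n).
Proof.
apply/intmx_block; split; try exact: intmx0.
- exact: intmx_scalar.
- by apply: intmxN; apply: intmx_scalar.
Qed.

Lemma int_tau g : intmx g -> intmx (tau g).
Proof. by move=> ig; rewrite tauE; do 2?apply: intmxM => //; exact: int_theta. Qed.

Lemma congr_tau N g h : intmx g -> intmx h -> congrmx N g h -> congrmx N (tau g) (tau h).
Proof.
move=> ig ih c; rewrite !tauE.
have it := int_theta.
by apply: congrmxM => //; [exact: intmxM | exact: congrmxM].
Qed.

Lemma SpZ1 : @SpZ R n 1%:M.
Proof. by split; [exact: Sp1 | exact: intmx_scalar]. Qed.

Lemma SpZM g h : SpZ g -> SpZ h -> SpZ (g *m h).
Proof. by move=> [? ?] [? ?]; split; [exact: SpM | exact: intmxM]. Qed.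

Lemma SpZV g : SpZ g -> SpZ (invmx g).
Proof.
move=> [gS ig]; split; [exact: SpV | rewrite Sp_inv //].
by apply/intmxN/intmxM; [apply: intmxM | ]; try exact: int_J; exact: intmxT.
Qed.

Lemma SpZ_tau g : SpZ g -> SpZ (tau g).
Proof. by move=> [? ?]; split; [exact: Sp_tau | exact: int_tau]. Qed.

Lemma congr_mulV N g h : SpZ g -> SpZ h -> congrmx N g h -> congrmx N (g *m invmx h) 1%:M.
Proof.
move=> gZ hZ c; rewrite -(mulmxV (Sp_unit hZ.1)).
by apply: congrmxM => //; [exact: hZ.2 | exact: (SpZV hZ).2].
Qed.

Lemma congr_inv N g h : SpZ g -> SpZ h -> congrmx N g h -> congrmx N (invmx g) (invmx h).
Proof.
move=> gZ hZ c; rewrite -[X in congrmx _ X](mulKmx (Sp_unit hZ.1)).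
rewrite -[X in congrmx _ _ X]mulmx1.
apply: congrmxM => //; try exact: (SpZV hZ).2.
  by apply: intmxM; [exact: hZ.2 | exact: (SpZV gZ).2].
by apply: congr_mulV => //; apply: congrmx_sym.
Qed.

Lemma GammaN1 N : @GammaN R n N 1%:M.
Proof. by split; [exact: SpZ1 | exact: congrmx_refl]. Qed.

Lemma GammaNM N g h : GammaN N g -> GammaN N h -> GammaN N (g *m h).
Proof.
move=> [gZ cg] [hZ ch]; split; first exact: SpZM.
rewrite -[1%:M]mul1mx; apply: congrmxM => //; [exact: SpZ1.2 | exact: hZ.2].
Qed.

Lemma GammaNV N g : GammaN N g -> GammaN N (invmx g).
Proof.
move=> [gZ cg]; split; first exact: SpZV.
rewrite -[X in congrmx _ X]mul1mx; apply: congr_mulV => //; [exact: SpZ1 |].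
exact: congrmx_sym.
Qed.

Lemma GammaN_tau N g : GammaN N g -> GammaN N (tau g).
Proof.
move=> [gZ cg]; split; first exact: SpZ_tau.
by rewrite -tau1; apply: congr_tau => //; [exact: gZ.2 | exact: SpZ1.2].
Qed.

Lemma GammaN_conj N g h : SpZ g -> GammaN N h -> GammaN N (g *m h *m invmx g).
Proof.
move=> gZ [hZ ch]; split; first by apply: SpZM; [exact: SpZM | exact: SpZV].
apply: congr_mulV => //; first exact: SpZM.
rewrite -[X in congrmx _ _ X]mulmx1; apply: congrmxM => //.
  exact: gZ.2.
exact: hZ.2.
Qed.

(** Since tau only changes the sign of B and C, tau(g) is congruent to g modulo 4m exactly when 2B
    and 2C vanish modulo 4m. In this form closure under products and inverses is immediate, and so
    is the membership of tau(g) g^-1 in Gamma(4m). *)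
Lemma Gamma2m2E m g : (0 < m)%N ->
  Gamma2m2 m g <-> [/\ SpZ g, congrmx 2 g 1%:M & congrmx (4 * m) (tau g) g].
Proof.
move=> m0.
have two (B : 'M[R]_n) : congrmx (4 * m) (- B) B <-> congrmx (2 * m) B 0.
  have e (x : R) : (- x - x) / (4 * m)%:R = - ((x - 0) / (2 * m)%:R).
    by rewrite !natrM; field; rewrite pnatr_eq0 -lt0n m0.
  by split=> h i j; have := h i j; rewrite !mxE e rpredN.
have e2 : congrmx 2 g 1%:M <-> [/\ congrmx 2 (ulsubmx g) 1%:M, congrmx 2 (ursubmx g) 0,
    congrmx 2 (dlsubmx g) 0 & congrmx 2 (drsubmx g) 1%:M].
  by rewrite -{1}[g]submxK scalar_mx_block; exact: congrmx_block.
have e4 : congrmx (4 * m) (tau g) g <-> [/\ congrmx (4 * m) (ulsubmx g) (ulsubmx g),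
    congrmx (4 * m) (- ursubmx g) (ursubmx g), congrmx (4 * m) (- dlsubmx g) (dlsubmx g)
    & congrmx (4 * m) (drsubmx g) (drsubmx g)].
  by rewrite /tau -{5}[g]submxK; exact: congrmx_block.
split=> [[gZ [cA [cD [cB cC]]]]|[gZ /e2[cA cB cC cD] /e4[_ /two cB' /two cC' _]]].
  have m20 : (0 < 2 * m)%N by rewrite muln_gt0.
  have d2 : (2 %| 2 * m)%N by rewrite dvdn_mulr.
  split=> //; first by apply/e2; split=> //; [apply: congrmx_dvd cB | apply: congrmx_dvd cC].
  by apply/e4; split=> //; apply/two.
by do 4?split=> //.
Qed.

(** The tau-fixed points of Sp(2n, Z) are the block matrices diag(A, A^-T), and integrality of the
    second block is integrality of A^-1. *)
Lemma GammaLE N k : GammaL N k <-> [/\ SpZ k, tau k = k & congrmx N k 1%:M].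
Proof.
split=> [[A [[Au [iA iAi]] cA] <-]|[kZ tk ck]].
  split.
  - split; first exact: embGL_Sp.
    by apply/intmx_block; split; rewrite -?trmx_inv //; [exact: intmx0..|exact: intmxT].
  - rewrite /tau /embGL block_mxKul block_mxKur block_mxKdl block_mxKdr.
    by rewrite oppr0.
  - rewrite scalar_mx_block; apply/congrmx_block; split=> //.
    rewrite -trmx_inv -trmx1; apply: congrmxT.
    rewrite -[X in congrmx _ X]mulmx1 -{2}(mulVmx Au); apply: congrmxM => //;
      [exact: intmx_scalar | exact: congrmx_sym].
have [Au kE] := tau_fixed kZ.1 tk.
exists (ulsubmx k) => //=.
have /intmx_block[iA _ _ iD] : intmx (embGL (ulsubmx k)) by rewrite -kE; exact: kZ.2.
have : congrmx N (embGL (ulsubmx k)) 1%:M by rewrite -kE.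
rewrite scalar_mx_block => /congrmx_block[cA _ _ _]; split=> //.
by split=> //; split=> //; rewrite -[invmx _]trmxK trmx_inv; exact: intmxT.
Qed.

Lemma GammaL_GammaN N k : GammaL N k -> GammaN N k.
Proof. by move=> /GammaLE[? _ ?]. Qed.

Lemma GammaL1 N : @GammaL R n N 1%:M.
Proof. by apply/GammaLE; split; [exact: SpZ1 | exact: tau1 | exact: congrmx_refl]. Qed.

Lemma GammaLM N g h : GammaL N g -> GammaL N h -> GammaL N (g *m h).
Proof.
move=> gL hL; have [ghZ c] := GammaNM (GammaL_GammaN gL) (GammaL_GammaN hL).
move/GammaLE: gL => [gZ tg _]; move/GammaLE: hL => [hZ th _].
by apply/GammaLE; split=> //; rewrite tauM tg th.
Qed.

Lemma GammaLV N g : GammaL N g -> GammaL N (invmx g).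
Proof.
move=> gL; have [gZ c] := GammaNV (GammaL_GammaN gL).
move/GammaLE: gL => [gZ' tg _].
by apply/GammaLE; split=> //; rewrite tauV ?tg //; exact: gZ'.1.
Qed.

(** * Double cosets and cocycles at level 4m *)

Section Level.
Variable m : nat.
Hypothesis m0 : (0 < m)%N.
Local Notation G := (@GammaN R n (4 * m)).
Local Notation G2 := (@Gamma2m2 R n m).
Local Notation L2 := (@GammaL R n 2).

Lemma G2_SpZ g : G2 g -> SpZ g. Proof. by case. Qed.

Lemma GammaN_G2 g : G g -> G2 g.
Proof.
move=> gG; have [gZ cg] := gG; have [_ ct] := GammaN_tau gG.
apply/Gamma2m2E => //; split=> //.
  apply: congrmx_dvd cg; first by rewrite muln_gt0.
  by rewrite (dvdn_mulr _ (isT : (2 %| 4)%N)).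
by apply: congrmx_trans ct _; apply: congrmx_sym.
Qed.

Lemma G2M g h : G2 g -> G2 h -> G2 (g *m h).
Proof.
move=> /Gamma2m2E-/(_ m0)[gZ g2 gt] /Gamma2m2E-/(_ m0)[hZ h2 ht].
apply/Gamma2m2E => //; split; first exact: SpZM.
  by rewrite -[1%:M]mul1mx; apply: congrmxM => //; [exact: SpZ1.2 | exact: hZ.2].
by rewrite tauM; apply: congrmxM => //; [exact: gZ.2 | exact: (SpZ_tau hZ).2].
Qed.

Lemma G2V g : G2 g -> G2 (invmx g).
Proof.
move=> /Gamma2m2E-/(_ m0)[gZ g2 gt]; apply/Gamma2m2E => //; split.
- exact: SpZV.
- rewrite -[1%:M](mulmxV (unitmx1 R (n + n))) mul1mx; apply: congr_inv => //; exact: SpZ1.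
- by rewrite tauV; [apply: congr_inv => //; exact: SpZ_tau | exact: gZ.1].
Qed.

Lemma cocycle_of_G2 g : G2 g -> cocycle G (tau g *m invmx g).
Proof.
move=> /Gamma2m2E-/(_ m0)[gZ g2 gt]; split.
  split; first by apply: SpZM; [exact: SpZ_tau | exact: SpZV].
  by apply: congr_mulV => //; exact: SpZ_tau.
have gS := gZ.1.
rewrite tauM tauK tauV // !mulmxA mulmxKV ?Sp_unit // mulmxV ?Sp_unit //.
exact: Sp_tau.
Qed.

(* g' = h g k, where k = g^-1 h^-1 g' is fixed by tau *)
Lemma cohomologous_factor g g' h : G2 g -> G2 g' -> G h ->
  tau g' *m invmx g' = tau h *m (tau g *m invmx g) *m invmx h ->
  exists2 k, L2 k & g' = h *m g *m k.
Proof.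
move=> gG g'G hG e.
have hG2 := GammaN_G2 hG.
have hgG2 := G2M hG2 gG.
have kG2 := G2M (G2V hgG2) g'G.
have [hgS g'S] : Sp (h *m g) /\ Sp g' by case: (G2_SpZ hgG2); case: (G2_SpZ g'G).
have hgu := Sp_unit hgS; have g'u := Sp_unit g'S.
have gu := Sp_unit (G2_SpZ gG).1; have hu := Sp_unit hG.1.1.
exists (invmx (h *m g) *m g'); last by rewrite mulKVmx.
apply/GammaLE; move: kG2 => /Gamma2m2E-/(_ m0)[kZ k2 _]; split=> //.
rewrite tauM tauV //.
have -> : tau g' = tau (h *m g) *m (invmx (h *m g) *m g').
  by rewrite -[LHS](mulmxKV g'u) e tauM invmxM // !mulmxA.
by rewrite mulKmx // Sp_unit //; exact: Sp_tau.
Qed.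

(** The factor k is fixed by tau, so it cancels in tau(hgk) (hgk)^-1. *)
Lemma factor_cohomologous g k h : SpZ g -> G h -> L2 k ->
  cohomologous G (tau g *m invmx g) (tau (h *m g *m k) *m invmx (h *m g *m k)).
Proof.
move=> gZ hG /GammaLE[kZ tk _]; exists h => //.
have gu := Sp_unit gZ.1; have hu := Sp_unit hG.1.1; have ku := Sp_unit kZ.1.
rewrite !tauM tk !invmxM ?unitmx_mul ?hu ?gu //.
by rewrite !mulmxA mulmxK.
Qed.

Lemma dcoset_self g : dcoset G L2 g g.
Proof.
exists 1%:M; first exact: GammaN1.
by exists 1%:M; [exact: GammaL1 | rewrite mul1mx mulmx1].
Qed.

Lemma dcoset_factor g h k : G h -> L2 k -> dcoset G L2 (h *m g *m k) = dcoset G L2 g.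
Proof.
move=> hG kL; have hu := Sp_unit hG.1.1; have ku := Sp_unit (GammaL_GammaN kL).1.1.
apply/seteqP; split=> x [h' h'G [k' k'L ->]].
  exists (h' *m h); first exact: GammaNM.
  by exists (k *m k'); [exact: GammaLM | rewrite !mulmxA].
exists (h' *m invmx h); first by apply: GammaNM => //; exact: GammaNV.
exists (invmx k *m k'); first by apply: GammaLM => //; exact: GammaLV.
by rewrite !mulmxA mulmxKV // mulmxK.
Qed.

Lemma dcosetP g g' :
  dcoset G L2 g = dcoset G L2 g' <->
  exists2 h, G h & exists2 k, L2 k & g' = h *m g *m k.
Proof.
split=> [e|[h hG [k kL ->]]]; last by rewrite dcoset_factor.
by have := dcoset_self g'; rewrite -e.
Qed.

Lemma dcoset_cohomologous g g' : G2 g -> G2 g' ->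
  dcoset G L2 g = dcoset G L2 g' <->
  cohomologous G (tau g *m invmx g) (tau g' *m invmx g').
Proof.
move=> gG g'G; split=> [/dcosetP[h hG [k kL ->]]|[h hG e]].
  by apply: factor_cohomologous => //; exact: G2_SpZ.
apply/dcosetP; exists h => //.
exact: cohomologous_factor e.
Qed.

(** If g and g' agree modulo 4m, then g g'^-1 lies in Gamma(4m). The double coset therefore depends
    only on the residues of the entries, which take finitely many values. *)
Lemma finite_dcosets : finite_set (dcoset G L2 @` G2).
Proof.
have N0 : (0 < 4 * m)%N by rewrite muln_gt0.
pose code (g : 'M[R]_(n + n)) : 'M['I_(4 * m).+1]_(n + n) :=
  \matrix_(i, j) inord `|(Num.floor (g i j) %% (4 * m)%:Z)%Z|%N.
have codeP g g' : SpZ g -> SpZ g' -> code g = code g' -> congrmx (4 * m) g g'.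
  move=> gZ g'Z e i j; move/matrixP/(_ i j)/(congr1 val): e; rewrite !mxE /=.
  set N := (4 * m)%N in N0 *.
  have [a ga] : exists a : int, g i j = a%:~R by apply/intrP; exact: gZ.2.
  have [b gb] : exists b : int, g' i j = b%:~R by apply/intrP; exact: g'Z.2.
  rewrite ga gb !intrKfloor.
  have md (c : int) : (`|(c %% N)%Z|%N < N.+1)%N.
    rewrite ltnS -lez_nat gez0_abs ?modz_ge0 ?eqz_nat -?lt0n //.
    by apply/ltW; rewrite ltz_mod // eqz_nat -lt0n.
  rewrite !inordK // => h.
  have {}h : (a %% N)%Z = (b %% N)%Z.
    by rewrite -[LHS]gez0_abs ?modz_ge0 ?eqz_nat -?lt0n // h gez0_abs // modz_ge0 // eqz_nat -lt0n.
  have /dvdzP[q hq] : (N %| a - b)%Z by rewrite -eqz_mod_dvd; apply/eqP.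
  rewrite -intrB hq intrM mulfK ?intr_int //.
  by rewrite intr_eq0 eqz_nat -lt0n.
(* Each code is sent to the double coset of a chosen representative. The default 0 arises only for
   codes that no element attains, and only an inclusion is required. *)
apply: (@sub_finite_set _ _
  ((fun c => dcoset G L2 (xget 0 [set g | G2 g /\ code g = c])) @` setT)).
  move=> _ [g gG <-] /=; exists (code g) => //.
  case: xgetP => [g' _ [g'G e]|/(_ g)]; last by case.
  apply/dcosetP; exists (g *m invmx g').
    have gZ := G2_SpZ gG; have g'Z := G2_SpZ g'G.
    split; first by apply: SpZM => //; exact: SpZV.
    by apply: congr_mulV => //; apply: codeP.
  exists 1%:M; first exact: GammaL1.
  by rewrite mulmx1 mulmxKV // Sp_unit //; exact: (G2_SpZ g'G).1.
exact/finite_image/finite_finset.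
Qed.

End Level.
End Groups.

(** * Triviality of cocycles in Gamma_2m(2) *)

Section IntegralFrames.
Context {R : realType}.

Lemma intmx_intr p q (A : 'M[int]_(p, q)) : intmx (map_mx intr A : 'M[R]_(p, q)).
Proof. by move=> i j; rewrite mxE intr_int. Qed.

Lemma congrmx_int N p q (A B : 'M[R]_(p, q)) : (0 < N)%N ->
  congrmx N A B -> intmx B -> intmx A.
Proof.
move=> N0 c iB i j; rewrite -(subrK (B i j) (A i j)) rpredD //.
have NR : (N%:R : R) != 0 by rewrite pnatr_eq0 -lt0n.
by rewrite -(divfK NR (A i j - B i j)) rpredM ?rpred_nat.
Qed.

Lemma int_unitmx_intr p (A : 'M[int]_p) : A \in unitmx ->
  (map_mx intr A : 'M[R]_p) \in unitmx /\ intmx (invmx (map_mx intr A : 'M[R]_p)).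
Proof.
move=> Au; have e : (map_mx intr A : 'M[R]_p) *m map_mx intr (invmx A) = 1%:M.
  by rewrite -map_mxM mulmxV // map_mx1.
have [u _] := mulmx1_unit e; split=> //.
have -> : invmx (map_mx intr A : 'M[R]_p) = map_mx intr (invmx A).
  by apply: (can_inj (mulKmx u)); rewrite e mulmxV.
exact: intmx_intr.
Qed.

(* If M = L D T is a Smith form, then the elementary divisors of M are odd, so
   replacing D by the identity does not change M modulo 2. *)
Lemma unimodular_frame p q (M : 'M[R]_(p + q, p)) :
  intmx M -> congrmx 2 M (col_mx 1%:M 0) ->
  exists a : 'M[R]_(p + q, p), exists c : 'M[R]_(p, p + q), exists T : 'M[R]_p,
  [/\ intmx a /\ intmx c, c *m a = 1%:M, congrmx 2 a (col_mx 1%:M 0),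
      T \in unitmx & M = a *m T].
Proof.
move=> iM cM.
have ME : M = map_mx intr (map_mx (@Num.floor R) M).
  by apply/matrixP => i j; rewrite !mxE floorK.
have [L Lu [T Tu [d _ sE]]] := int_Smith_normal_form (map_mx (@Num.floor R) M).
pose LR := map_mx intr L : 'M[R]_(p + q); pose TR := map_mx intr T : 'M[R]_p.
have [LRu iLi] := int_unitmx_intr Lu; have [TRu iTi] := int_unitmx_intr Tu.
have iL : intmx LR by exact: intmx_intr.
have iT : intmx TR by exact: intmx_intr.
pose I0 : 'M[R]_(p + q, p) := col_mx 1%:M 0.
pose D := diag_mx (\row_(j < p) (d`_j)%:~R) : 'M[R]_p.
have iI : intmx I0.
  move=> i j; rewrite -(splitK i); case: (fintype.split i) => i' /=;
    by rewrite (col_mxEu, col_mxEd) mxE ?rpred_nat.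
have iD : intmx D by move=> i j; rewrite !mxE rpredMn ?intr_int.
have {sE} ME' : M = LR *m I0 *m D *m TR.
  rewrite ME sE !map_mxM -!mulmxA; congr (_ *m _); rewrite mulmxA; congr (_ *m _).
  rewrite mul_col_mx mul1mx mul0mx; apply/matrixP => i j.
  rewrite -(splitK i); case: (fintype.split i) => i' /=.
    by rewrite col_mxEu !mxE /= -rmorphMn.
  by rewrite col_mxEd !mxE /= gtn_eqF ?mulr0n // ltn_addr.
have I0I : I0^T *m I0 = 1%:M.
  by rewrite /I0 tr_col_mx trmx1 trmx0 mul_row_col mulmx1 mul0mx addr0.
(* Conjugating I0^T M, which is congruent to 1, by [TR] brings D to the right end. Each diagonal
   entry then exhibits an odd integral multiple of an elementary divisor, which must itself be
   odd. *)
have cD : congrmx 2 (TR *m I0^T *m LR *m I0 *m D) 1%:M.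
  have -> : TR *m I0^T *m LR *m I0 *m D = TR *m (I0^T *m M) *m invmx TR.
    by rewrite ME' !mulmxA mulmxK.
  rewrite -(mulmxV TRu); apply: congrmxM => //.
  rewrite -[X in congrmx _ _ X]mulmx1; apply: congrmxM => //.
    by apply: intmxM => //; exact: intmxT.
  by rewrite -I0I; apply: congrmxM => //; exact: intmxT.
have dodd (j : 'I_p) : exists e : int, d`_j = 2 * e + 1.
  have iX : intmx (TR *m I0^T *m LR *m I0).
    by do !apply: intmxM => //; exact: intmxT.
  have := cD j j; move: (TR *m I0^T *m LR *m I0) iX => X iX.
  rewrite mul_mx_diag !mxE eqxx.
  have /intrP[x ->] := iX j j; rewrite mulr1n => /intrP[y hy].
  have {}hy : x * d`_j = 2 * y + 1.
    apply: (@intr_inj R); rewrite intrM intrD intrM.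
    by move: hy; move: (x%:~R : R) => x' hy; lra.
  have dE := divz_eq d`_j 2; exists (d`_j %/ 2)%Z.
  have := ltz_pmod d`_j (isT : 0 < 2 :> int).
  have := modz_ge0 d`_j (isT : 2 != 0 :> int).
  move: dE hy; move: (d`_j %% 2)%Z (d`_j %/ 2)%Z => r t -> hy r0 r2.
  have [r1|->] : r = 0 \/ r = 1 by lia.
    by move: hy; rewrite r1; nia.
  by rewrite mulrC.
have Du : D \in unitmx.
  rewrite unitmxE unitfE det_diag prodf_seq_neq0; apply/allP => j _ /=.
  by rewrite mxE intr_eq0; have [e ->] := dodd j; apply/eqP; lia.
have D1 : congrmx 2 1%:M D.
  move=> i j; rewrite !mxE; case: eqP => _; last by rewrite subrr mul0r rpred0.
  have [e ->] := dodd i; rewrite !mulr1n intrD intrM /=.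
  have -> : (1 - (2%:~R * e%:~R + 1%:~R)) / 2%:R = - e%:~R :> R by lra.
  by rewrite rpredN intr_int.
(* The first witness is M with D replaced by 1; keeping [TR] in it makes it congruent to M. The last
   one conjugates D by [TR], so that the product with the first is M again. *)
exists (LR *m I0 *m TR), (invmx TR *m I0^T *m invmx LR), (invmx TR *m D *m TR); split.
- by split; do !apply: intmxM => //; exact: intmxT.
- by rewrite !mulmxA mulmxKV // -(mulmxA _ I0^T) I0I mulmx1 mulVmx.
- apply: congrmx_trans cM; rewrite ME' -[X in congrmx _ (X *m _)]mulmx1.
  by apply: congrmxM => //; [do !apply: intmxM | apply: congrmxM => //;
    [exact: intmxM | exact: intmx_scalar]].
- by rewrite !unitmx_mul unitmx_inv TRu Du.
- by rewrite ME' !mulmxA mulmxK.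
Qed.

End IntegralFrames.

(** * Symplectic bases adapted to a cocycle *)

Section Cocycles.
Context {R : realType} {n : nat}.
Variable m : nat.
Hypothesis m0 : (0 < m)%N.
Local Notation G := (@GammaN R n (4 * m)).
Local Notation G2 := (@Gamma2m2 R n m).
Local Notation J := (@Jmx R n).
Local Notation theta := (@thetamx R n).

(* s = theta gamma is an antisymplectic involution, congruent to theta, and
   P = (1 + s)/2 is integral; the eigenlattices P Z^2n and (1 - P) Z^2n are
   Lagrangian and dual to each other, and g is a symplectic basis adapted to them. *)
Lemma cocycle_trivial gamma : cocycle G gamma ->
  exists2 g, G2 g & gamma = tau g *m invmx g.
Proof.
move=> [gG gtg]; have [[gS gi] gc] := gG.
pose s := theta *m gamma.
have it := @int_theta R n.
have ss : s *m s = 1%:M by rewrite /s !mulmxA -tauE; apply: mulmx1C.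
have sJ : s^T *m J *m s = - J.
  have -> : s^T *m J *m s = gamma^T *m (theta *m J *m theta) *m gamma.
    by rewrite /s trmx_mul trtheta !mulmxA.
  by rewrite thetaJ mulmxN mulNmx gS.
have s_theta : congrmx (4 * m) s theta.
  by rewrite -[X in congrmx _ _ X]mulmx1; apply: congrmxM.
have sJ' : s^T *m J = - (J *m s).
  by rewrite -[LHS]mulmx1 -ss mulmxA sJ mulNmx.
pose P := 2^-1 *: (1%:M + s); pose P' := 2^-1 *: (1%:M - s).
have sP : s *m P = P by rewrite /P -scalemxAr mulmxDr mulmx1 ss addrC.
have sP' : s *m P' = - P'.
  by rewrite /P' -scalemxAr mulmxBr mulmx1 ss -scalerN opprB.
have h2 : (2 : R) != 0 by rewrite pnatr_eq0.
have PP' : P + P' = 1%:M.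
  by rewrite /P /P' -scalerDr addrACA subrr addr0 -mulr2n -scaler_nat scalerA mulVf // scale1r.
have Jadj (x y : 'M[R]_(n + n, n)) : (s *m x)^T *m J *m y = - (x^T *m J *m (s *m y)).
  have -> : (s *m x)^T *m J *m y = x^T *m (s^T *m J) *m y.
    by rewrite trmx_mul !mulmxA.
  by rewrite sJ' mulmxN mulNmx !mulmxA.
have oppI (A : 'M[R]_n) : A = - A -> A = 0.
  move=> e; apply/matrixP => i j; move/matrixP/(_ i j): e; rewrite !mxE => /eqP.
  by rewrite -addr_eq0 -mulr2n mulrn_eq0 /= => /eqP.
have isoP (x y : 'M[R]_(n + n, n)) : s *m x = x -> s *m y = y -> x^T *m J *m y = 0.
  by move=> sx sy; apply: oppI; rewrite -{1}sx Jadj sy.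
have isoP' (x y : 'M[R]_(n + n, n)) : s *m x = - x -> s *m y = - y -> x^T *m J *m y = 0.
  move=> sx sy; apply: oppI; rewrite -{1}[x]opprK -sx linearN /= !mulNmx Jadj sy.
  by rewrite mulmxN opprK.
pose E0 : 'M[R]_(n + n) := block_mx 1%:M 0 0 0.
have E0E : E0 = 2^-1 *: (1%:M + theta).
  rewrite scalar_mx_block add_block_mx !addr0 subrr scale_block_mx !scaler0.
  by rewrite -mulr2n -scaler_nat scalerA mulVf // scale1r.
have iE0 : intmx E0.
  by apply/intmx_block; split; try exact: intmx0; exact: intmx_scalar.
(* Halving costs a factor 2 in the modulus: s is congruent to theta modulo 4, so (1 + s)/2 is
   congruent to (1 + theta)/2 = [E0] modulo 2 only. *)
have cP : congrmx 2 P E0.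
  have : congrmx 4 s theta.
    by apply: congrmx_dvd s_theta; [rewrite muln_gt0 | rewrite dvdn_mulr].
  move=> /congrmxE c; apply/congrmxE.
  by rewrite E0E /P -scalerBr opprD addrACA subrr add0r scalerA -invfM -natrM.
have iP : intmx P by exact: congrmx_int cP iE0.
have iP' : intmx P'.
  have -> : P' = 1%:M - P by rewrite -PP' addrC addKr.
  by apply: intmxD; [exact: intmx_scalar | exact: intmxN].
pose I0 : 'M[R]_(n + n, n) := col_mx 1%:M 0.
have iI : intmx I0.
  move=> i j; rewrite -(splitK i); case: (fintype.split i) => i' /=;
    by rewrite (col_mxEu, col_mxEd) mxE ?rpred_nat.
have E0I : E0 *m I0 = I0.
  by rewrite mul_block_col !mul0mx mulmx1 !addr0.
have [||a [c [T [[ia ic] ca a1 Tu MaT]]]] := @unimodular_frame R n n (P *m I0).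
- exact: intmxM.
- by rewrite -/I0 -[X in congrmx _ _ X]E0I; apply: congrmxM.
have sa : s *m a = a.
  have : s *m (P *m I0) = P *m I0 by rewrite mulmxA sP.
  by rewrite MaT mulmxA => /(congr1 (mulmx^~ (invmx T))); rewrite !mulmxK.
(* The columns of -J c^T are dual to those of a, because a^T J (-J c^T) = (c a)^T = 1. Projecting
   them to the -1 eigenspace subtracts a part in the +1 eigenspace, which pairs to zero with a. *)
pose b := P' *m (- J) *m c^T.
have iJ := @int_J R n.
have ib : intmx b by do 2?apply: intmxM => //; [exact: intmxN | exact: intmxT].
have sb : s *m b = - b by rewrite /b !mulmxA sP' !mulNmx.
have aJb : a^T *m J *m b = 1%:M.
  have -> : b = - J *m c^T - P *m (- J *m c^T).
    rewrite /b; have -> : P' = 1%:M - P by rewrite -PP' addrC addKr.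
    by rewrite !mulmxBl mul1mx mulmxA.
  rewrite mulmxBr (isoP a (P *m _)) ?subr0 //; last by rewrite mulmxA sP.
  rewrite mulmxA mulmxN -(mulmxA a^T) JJ mulmxN opprK mulmx1.
  by rewrite -trmx_mul ca trmx1.
have bJa : b^T *m J *m a = - 1%:M.
  have -> : b^T *m J *m a = - (a^T *m J *m b)^T.
    by rewrite (trmx_mul (a^T *m J)) (trmx_mul a^T) trmxK trJ mulNmx mulmxN opprK mulmxA.
  by rewrite aJb trmx1.
pose g := row_mx a b.
(* This diagonalisation of s amounts to tau(g) = gamma g, since s = theta gamma. *)
have sg : s *m g = g *m theta.
  rewrite mul_mx_row sa sb /g /theta mul_row_block !mulmx0 mulmxN !mulmx1.
  by rewrite addr0 add0r.
have ig : intmx g.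
  move=> i j; rewrite -(splitK j); case: (fintype.split j) => j' /=;
    by rewrite (row_mxEl, row_mxEr).
have gSp : Sp g.
  rewrite /Sp /= /g tr_row_mx mul_col_mx mul_col_row aJb bJa.
  by rewrite isoP // isoP'.
have gu := Sp_unit gSp.
have tg : tau g = gamma *m g.
  by rewrite tauE -mulmxA -sg /s !mulmxA thetaK mul1mx.
exists g; last by rewrite tg mulmxK.
apply/Gamma2m2E => //; split=> //; last first.
  by rewrite tg -[X in congrmx _ _ X]mul1mx; apply: congrmxM => //; exact: intmx_scalar.
pose I1 : 'M[R]_(n + n, n) := col_mx 0 1%:M.
(* The upper half vanishes modulo 2 because b = P' b and P' is congruent to diag(0, 1). The lower
   half comes from a^T J b = 1 with a congruent to [I0]. *)
have b1 : congrmx 2 b I1.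
  have bu : congrmx 2 (usubmx b) 0.
    have P'b : P' *m b = b.
      rewrite /P' -scalemxAl mulmxBl mul1mx sb opprK -mulr2n -scaler_nat scalerA.
      by rewrite mulVf // scale1r.
    have cP' : congrmx 2 P' (1%:M - E0).
      have -> : P' = 1%:M - P by rewrite -PP' addrC addKr.
      move/congrmxE: (congrmx_sym cP) => h; apply/congrmxE.
      by rewrite opprB addrC addrA subrK.
    have iE1 : intmx (1%:M - E0) by apply: intmxD; [exact: intmx_scalar | exact: intmxN].
    have : congrmx 2 (P' *m b) ((1%:M - E0) *m b) by apply: congrmxM.
    rewrite P'b -[X in congrmx _ _ X]vsubmxK -mul_usub_mx.
    have -> : usubmx (1%:M - E0) = row_mx 0 0.
      rewrite scalar_mx_block opp_block_mx add_block_mx subrr !oppr0 !addr0.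
      by rewrite block_mxEv col_mxKu.
    rewrite row_mx0 mul0mx => h i j; have := h (lshift n i) j.
    by rewrite col_mxEu !mxE.
  have bd : congrmx 2 (dsubmx b) 1%:M.
    have -> : dsubmx b = I0^T *m J *m b.
      rewrite /I0 /Jmx tr_col_mx trmx1 trmx0 mul_row_block !mul0mx !mulmx0 mulmx1 !addr0.
      by rewrite -[b in RHS]vsubmxK mul_row_col mul0mx mul1mx add0r.
    rewrite -aJb; apply: congrmxM => //; first by apply: intmxM => //; exact: intmxT.
    apply: congrmxM => //; first exact: intmxT.
    exact/congrmxT/congrmx_sym.
  move=> i j; rewrite -(vsubmxK b) -(splitK i); case: (fintype.split i) => i' /=.
    by rewrite !col_mxEu; exact: bu.
  by rewrite !col_mxEd; exact: bd.
have -> : 1%:M = row_mx I0 I1 :> 'M[R]_(n + n).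
  by rewrite scalar_mx_block block_mxEh.
move=> i j; rewrite -(splitK j); case: (fintype.split j) => j' /=.
  by rewrite !row_mxEl; exact: a1.
by rewrite !row_mxEr; exact: b1.
Qed.

End Cocycles.

(** * Real points *)

Section RealPoints.
Context {R : realType} {n : nat}.
Variable m : nat.
Hypothesis m0 : (0 < m)%N.
Local Notation G := (@GammaN R n (4 * m)).
Local Notation G2 := (@Gamma2m2 R n m).
Local Notation L2 := (@GammaL R n 2).
Implicit Types (g h k : 'M[R]_(n + n)) (Z : 'M[R[i]]_n) (Y : 'M[R]_n).

Lemma G_Sp g : G g -> Sp g. Proof. by case=> [[]]. Qed.

Lemma G2_Sp g : G2 g -> Sp g. Proof. by case=> [[]]. Qed.

Lemma actK g Z : Sp g -> hn Z -> act (invmx g) (act g Z) = Z.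
Proof.
by move=> gS hZ; have iS := SpV gS; rewrite -actM // mulVmx ?act1 // Sp_unit.
Qed.

(** The element h^-1 g of Gamma(4m) fixes Z, and 4m >= 4. Equalities between points thus lift to
    equalities in the group. *)
Lemma G_free g h Z : G g -> G h -> hn Z -> act g Z = act h Z -> g = h.
Proof.
move=> gG hG hZ e; have gS := G_Sp gG; have hS := G_Sp hG.
have [[kS _] kc] := GammaNM (GammaNV hG) gG.
have N4 : (4 <= 4 * m)%N by rewrite leq_pmulr.
have k1 : invmx h *m g = 1%:M.
  apply: (congr_fixed_point_eq1 N4 kS hZ kc).
  have iS := SpV hS.
  by rewrite actM // e actK.
by rewrite -[g](mulKVmx (Sp_unit hS)) k1 mulmx1.
Qed.

Lemma Gorbit_self Z : Gorbit G Z Z.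
Proof. by exists 1%:M; [exact: GammaN1 | exact: act1]. Qed.

Lemma Gorbit_act h Z : G h -> hn Z -> Gorbit G (act h Z) = Gorbit G Z.
Proof.
move=> hG hZ; have hS := G_Sp hG; apply/seteqP; split=> _ [g gG <-].
  exists (g *m h); first exact: GammaNM.
  by rewrite actM //; exact: G_Sp.
exists (g *m invmx h); first by apply: GammaNM => //; exact: GammaNV.
by rewrite actM ?actK //; [exact: G_Sp | exact: SpV | exact: hn_act].
Qed.

Lemma GorbitP Z Z' : hn Z ->
  Gorbit G Z = Gorbit G Z' <-> exists2 h, G h & Z' = act h Z.
Proof.
move=> hZ; split=> [e|[h hG ->]]; last by rewrite Gorbit_act.
by have := Gorbit_self Z'; rewrite -e => -[h hG <-]; exists h.
Qed.

Lemma tauX_Gorbit Z : hn Z -> tauX (Gorbit G Z) = Gorbit G (tauZ Z).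
Proof.
move=> hZ; apply/seteqP; split.
  move=> _ [_ [g gG <-] <-]; exists (tau g); first exact: GammaN_tau.
  by rewrite tauZ_act //; exact: G_Sp.
move=> _ [g gG <-]; exists (act (tau g) Z); first by exists (tau g) => //; exact: GammaN_tau.
by rewrite tauZ_act ?tauK //; apply/Sp_tau/G_Sp.
Qed.

Lemma XR_fixed_points : XR G = Gorbit G @` (\bigcup_(gamma in G) hn_fix gamma).
Proof.
apply/seteqP; split=> [O [[Z hZ <-]]|_ [Z [g gG [hZ e]] <-]].
  rewrite tauX_Gorbit // => /esym/(GorbitP _ hZ)[g gG e].
  by exists Z => //; exists g.
split; first by exists Z.
by rewrite tauX_Gorbit //; symmetry; apply/GorbitP => //; exists g.
Qed.

Lemma hn_giCn g Z : Sp g -> giCn g Z -> hn Z.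
Proof. by move=> gS [Y /hn_iY hY <-]; exact: hn_act. Qed.

Lemma tauZ_giCn g Z : Sp g -> giCn g Z -> act (tau g *m invmx g) Z = tauZ Z.
Proof.
move=> gS gZ; have hZ := hn_giCn gS gZ; case: gZ hZ => Y CY <- hZ.
have hY := hn_iY CY; have tS := Sp_tau gS; have iS := SpV gS.
by rewrite actM // actK // tauZ_act // tauZ_iY.
Qed.

(** For W = g^-1 Z the equation becomes tau(W) = W, so W lies in i C_n. With [tauZ_giCn] this
    identifies g i C_n with the fixed locus of tau(g) g^-1. *)
Lemma giCn_fixed g Z : Sp g -> hn Z -> act (tau g *m invmx g) Z = tauZ Z -> giCn g Z.
Proof.
move=> gS hZ; have tS := Sp_tau gS; have iS := SpV gS; rewrite actM // => e.
have hW := hn_act iS hZ.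
have [|Y CY WY] := tauZ_fixed hW.
  by rewrite tauZ_act // tauV // -e actK.
by exists Y => //; rewrite -WY -actM // mulmxV ?act1 ?Sp_unit.
Qed.

(** Since diag(A, A^-T) sends iY to i A Y A^T, right multiplication by k does not enlarge the set.
    The reverse inclusion is the same fact for k^-1. *)
Lemma giCn_mulGL g k N : Sp g -> GammaL N k -> giCn (g *m k) = giCn g.
Proof.
move=> gS; have sub k' : GammaL N k' -> forall g', Sp g' -> giCn (g' *m k') `<=` giCn g'.
  move=> [A [[Au _] _] <-] g' g'S _ [Y CY <-].
  exists (A *m Y *m A^T); first exact: Cn_congr.
  by rewrite -act_embGL // -actM //; [exact: embGL_Sp | exact: hn_iY].
move=> kL; have kS := (GammaL_GammaN kL).1.1.
apply/seteqP; split; first exact: sub.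
rewrite -{1}[g](mulmxK (Sp_unit kS)); apply: sub; first exact: GammaLV.
exact: SpM.
Qed.

Lemma giCn_mulG g h : Sp g -> Sp h -> giCn (h *m g) = act h @` giCn g.
Proof.
move=> gS hS; apply/seteqP; split.
  move=> _ [Y CY <-]; exists (act g (iY Y)); first by exists Y.
  by rewrite actM //; exact: hn_iY.
by move=> _ [_ [Y CY <-] <-]; exists Y => //; rewrite actM //; exact: hn_iY.
Qed.

(** The point hZ lies on both g' i C_n and hg i C_n, so the cocycles of g' and hg both send it to
    tau(hZ). They agree by freeness. *)
Lemma giCn_orbit_cohomologous g g' h Z : G2 g -> G2 g' -> G h ->
  giCn g Z -> giCn g' (act h Z) ->
  tau g' *m invmx g' = tau h *m (tau g *m invmx g) *m invmx h.
Proof.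
move=> gG g'G hG gZ g'Z; have gS := G2_Sp gG; have hS := G_Sp hG.
have hgG := G2M m0 (GammaN_G2 m0 hG) gG.
have -> : tau h *m (tau g *m invmx g) *m invmx h = tau (h *m g) *m invmx (h *m g).
  by rewrite tauM invmxM ?Sp_unit // !mulmxA.
have hgZ : giCn (h *m g) (act h Z) by rewrite giCn_mulG //; exists Z.
have g'S := G2_Sp g'G.
apply: (@G_free _ _ (act h Z)).
- exact: (cocycle_of_G2 m0 g'G).1.
- exact: (cocycle_of_G2 m0 hgG).1.
- exact: hn_giCn g'Z.
- by rewrite !tauZ_giCn //; exact: SpM.
Qed.

(** Here tau(gamma) gamma Z = tau(gamma) tau(Z) = tau(gamma Z) = Z, and the action is free. *)
Lemma fixed_point_cocycle gamma Z : G gamma -> hn_fix gamma Z -> cocycle G gamma.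
Proof.
move=> gG [hZ e]; split=> //; have gS := G_Sp gG; apply: mulmx1C.
apply: (@G_free _ _ Z) => //.
- by apply: GammaNM => //; exact: GammaN_tau.
- exact: GammaN1.
- by have tS := Sp_tau gS; rewrite act1 actM // e -tauZ_act // e tauZK.
Qed.

Lemma giCn_conj_stable g h Z : G2 g -> @GammaL R n (4 * m) h -> giCn g Z ->
  giCn g (act (g *m h *m invmx g) Z).
Proof.
move=> gG hL [Y CY <-]; have gS := G2_Sp gG; have hS := (GammaL_GammaN hL).1.1.
have hY := hn_iY CY; have iS := SpV gS; have ghS := SpM gS hS.
rewrite actM //; last exact: hn_act.
by rewrite actK // -(giCn_mulGL gS hL); exists Y.
Qed.

(** For g' = g the equality of cocycles says that g^-1 h g is fixed by tau. Conjugation preserves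
    the congruence to 1 modulo 4m, so this element lies in Gamma_l(4m) and not merely in
    Gamma_l(2). *)
Lemma giCn_orbit_eq g Z1 Z2 : G2 g -> giCn g Z1 -> giCn g Z2 ->
  Gorbit G Z1 = Gorbit G Z2 <->
  exists2 h, @GammaL R n (4 * m) h & Z2 = act (g *m h *m invmx g) Z1.
Proof.
move=> gG g1 g2; have gZ := G2_SpZ gG; have gS := gZ.1; have gu := Sp_unit gS.
have h1 := hn_giCn gS g1.
split=> [/(GorbitP _ h1)[h hG e]|[h hL ->]]; last first.
  by rewrite Gorbit_act //; apply: GammaN_conj => //; exact: GammaL_GammaN.
exists (invmx g *m h *m g); last first.
  by rewrite !mulmxA mulmxV // mul1mx mulmxK.
have hu := Sp_unit (G_Sp hG).
have [kZ kc] := GammaN_conj (SpZV gZ) hG; rewrite invmxK in kZ kc.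
apply/GammaLE; split=> //.
have g2' : giCn g (act h Z1) by rewrite -e.
have := giCn_orbit_cohomologous gG gG hG g1 g2'.
rewrite !tauM tauV // => /(congr1 (fun M => invmx (tau g) *m M *m h *m g)).
rewrite !mulmxA mulVmx ?mul1mx; last by rewrite Sp_unit //; exact: Sp_tau.
rewrite mulmxKV // => ->.
by rewrite -(mulmxA _ (invmx g) g) mulVmx // mulmx1.
Qed.

Lemma img_dcoset g g' : G2 g -> dcoset G L2 g = dcoset G L2 g' ->
  Gorbit G @` giCn g = Gorbit G @` giCn g'.
Proof.
move=> gG /dcosetP[h hG [k kL ->]]; have gS := G2_Sp gG; have hS := G_Sp hG.
rewrite (giCn_mulGL (SpM hS gS) kL) giCn_mulG // image_comp.
by apply: eq_imagel => Z /(hn_giCn gS) hZ; rewrite /= Gorbit_act.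
Qed.

Lemma img_disjoint g g' : G2 g -> G2 g' -> dcoset G L2 g <> dcoset G L2 g' ->
  (Gorbit G @` giCn g) `&` (Gorbit G @` giCn g') = set0.
Proof.
move=> gG g'G ne; apply/seteqP; split=> // O [[Z gZ <-] [Z' g'Z]].
have hZ := hn_giCn (G2_Sp gG) gZ.
move=> /esym/(GorbitP _ hZ)[h hG e]; apply: ne; apply/dcoset_cohomologous => //.
by exists h => //; apply: giCn_orbit_cohomologous gZ _ => //; rewrite -e.
Qed.

Lemma XR_bigcup : XR G = \bigcup_(g in G2) (Gorbit G @` giCn g).
Proof.
rewrite XR_fixed_points; apply/seteqP; split.
  move=> _ [Z [gamma gG fZ] <-].
  have [g g2 ge] := cocycle_trivial m0 (fixed_point_cocycle gG fZ).
  exists g => //; exists Z => //; apply: giCn_fixed; first exact: G2_Sp.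
    exact: fZ.1.
  by rewrite -ge; exact: fZ.2.
move=> _ [g gG [Z gZ <-]]; have gS := G2_Sp gG; exists Z => //.
exists (tau g *m invmx g); first exact: (cocycle_of_G2 m0 gG).1.
by split; [exact: hn_giCn gZ | exact: tauZ_giCn].
Qed.

End RealPoints.

Theorem theorem4p4 (R : realType) (n m : nat) (hn0 : (0 < n)%N) (hm0 : (0 < m)%N) :
  let G := @GammaN R n (4 * m) in
  let G2 := @Gamma2m2 R n m in
  let img := fun g => (Gorbit G) @` (giCn g) in
  (* tau descends to an involution of X = G \ h_n *)
  ((forall Z, hn Z -> hn (tauZ Z) /\ tauX (Gorbit G Z) = Gorbit G (tauZ Z)) /\
   (forall O, Xpts G O -> Xpts G (tauX O) /\ tauX (tauX O) = O)) /\
  (* (i) *)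
  XR G = (Gorbit G) @` (\bigcup_(gamma in G) hn_fix gamma) /\
  (* (ii) *)
  ((forall g, G2 g -> forall h, @GammaL R n (4 * m) h ->
       forall Z, giCn g Z -> giCn g (act (g *m h *m invmx g) Z)) /\
   (forall g, G2 g -> forall Z1 Z2, giCn g Z1 -> giCn g Z2 ->
       (Gorbit G Z1 = Gorbit G Z2 <->
        exists2 h, @GammaL R n (4 * m) h & Z2 = act (g *m h *m invmx g) Z1)) /\
   (forall g, G2 g -> img g `<=` XR G) /\
   (forall g g', G2 g -> G2 g' ->
       dcoset G (@GammaL R n 2) g = dcoset G (@GammaL R n 2) g' -> img g = img g') /\
   (forall g g', G2 g -> G2 g' ->
       dcoset G (@GammaL R n 2) g <> dcoset G (@GammaL R n 2) g' -> img g `&` img g' = set0) /\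
   finite_set (dcoset G (@GammaL R n 2) @` G2) /\
   XR G = \bigcup_(g in G2) img g) /\
  (* (iii) *)
  ((forall g, G2 g -> G (tau g *m invmx g) /\ cocycle G (tau g *m invmx g)) /\
   (forall g g', G2 g -> G2 g' ->
       (dcoset G (@GammaL R n 2) g = dcoset G (@GammaL R n 2) g' <->
        cohomologous G (tau g *m invmx g) (tau g' *m invmx g'))) /\
   (forall gamma, cocycle G gamma ->
       exists2 g, G2 g & cohomologous G gamma (tau g *m invmx g))).
Proof.
move=> G G2 img; split.
  split=> [Z hZ|_ [Z hZ <-]].
    by split; [exact: hn_tauZ | exact: tauX_Gorbit].
  rewrite tauX_Gorbit //; have htZ := hn_tauZ hZ.
  by split; [exists (tauZ Z) | rewrite tauX_Gorbit // tauZK].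
split; first exact: XR_fixed_points.
split.
  split; first by move=> g gG h hL Z gZ; exact: (giCn_conj_stable gG hL gZ).
  split; first by move=> g gG Z1 Z2; exact: giCn_orbit_eq.
  split; first by move=> g gG O gO; rewrite /G XR_bigcup //; exists g.
  split; first by move=> g g' gG _; exact: img_dcoset.
  split; first by move=> g g'; exact: img_disjoint.
  by split; [exact: finite_dcosets | exact: XR_bigcup].
split; first by move=> g /(cocycle_of_G2 hm0) c; split=> //; case: c.
split; first by move=> g g'; exact: dcoset_cohomologous.
(* Surjectivity already holds for cocycles, so the identity serves as the cohomology. *)
move=> gamma /(cocycle_trivial hm0)[g gG ->]; exists g => //.
exists 1%:M; first exact: GammaN1.
by rewrite tau1 mul1mx invmx1 mulmx1.
Qed.
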